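(* Let $d\ge1$, let $w$ be a non-negative Radon measure on $S^{d-1}$ satisfying $\int_{S^{d-1}}(\bm n_\theta\cdot\bm e_i)(\bm n_\theta\cdot\bm e_j)\,dw(\theta)=\delta_{ij}$ for $i,j=1,\dots,d$, and let $\Phi$ be a non-negative, non-increasing function on $(0,\infty)$ with $\Phi(0)<\infty$. Let $\bm F:\mathbb R\to\mathbb R^d$ with $\bm F(0)=\bm 0$ be globally Lipschitz continuous with Lipschitz constant $L$. If $u_0\in L^\infty(\mathbb R^d)$, then there exists a unique continuously differentiable solution $u(t)\in L^\infty(\mathbb R^d)$, $t\in[0,\infty)$, to the Cauchy problem $$\partial_t u=\operatorname{div}^{\Phi}\bm F(u),\qquad u(\cdot,0)=u_0 .$$ Furthermore, if $|u_0|_{\mathrm{Lip}}<\infty$, then $u(t)$ is Lipschitz continuous in $\bm x\in\mathbb R^d$, with the explicit bound $$|u(\cdot,t)|_{\mathrm{Lip}}\le|u_0|_{\mathrm{Lip}}\exp\bigl(4L\,w(S^{d-1})\,\Phi(0)\,t\bigr).$$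
   Context: Increasing and decreasing parts: for a (locally) Lipschitz $f:\mathbb R\to\mathbb R$, $f^+(u)=\int_0^u\max\{0,f'(s)\}\,ds$ and $f^-(u)=\int_0^u\min\{0,f'(s)\}\,ds$. For $\bm y\in\mathbb R^d$, $u\in\mathbb R$ set $\mathfrak f^{\pm}(\bm y,u)=\pm[\bm F\cdot\bm y]^{\pm}(u)$, where $[\bm F\cdot\bm y](u)=\bm F(u)\cdot\bm y$. $S^{d-1}$ is the unit sphere of $\mathbb R^d$ ($S^0=\{1,-1\}$), $\bm n_\theta$ is the outward unit normal at $\theta\in S^{d-1}$, and $\bm e_i$ is the $i$th standard basis vector. From the measure $w$ on $S^{d-1}$ define the measure $\bm w$ on $\mathbb R^d$ in radial coordinates $\bm y=r\bm n_\theta$ by $d\bm w(\bm y)=r^{d-1}\,dr\,dw(\theta)$. Average upwind divergence of $\bm F(u)$ with filter $\Phi$: $$\operatorname{div}^{\Phi}\bm F(u)(\bm x)=\int_{\mathbb R^d}\frac{\Phi'(|\bm y|)}{|\bm y|^d}\Bigl\{\mathfrak f^+(\bm y,u(\bm x))-\mathfrak f^+(\bm y,u(\bm x+\bm y))+\mathfrak f^-(\bm y,u(\bm x))-\mathfrak f^-(\bm y,u(\bm x-\bm y))\Bigr\}\,d\bm w(\bm y).$$ Equivalently, since $\mathfrak f^\pm(r\bm n_\theta,u)=r\,\mathfrak f^\pm(\bm n_\theta,u)$, this is $\int_{S^{d-1}}\int_0^\infty\{\mathfrak f^+(\bm n_\theta,u(\bm x))-\mathfrak f^+(\bm n_\theta,u(\bm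 x+r\bm n_\theta))+\mathfrak f^-(\bm n_\theta,u(\bm x))-\mathfrak f^-(\bm n_\theta,u(\bm x-r\bm n_\theta))\}\,\Phi'(r)\,dr\,dw(\theta)$. Here $\Phi'(r)\,dr$ is the (non-positive) distributional derivative of $\Phi$ on $(0,\infty)$; at a jump at $r_0>0$ it is a Dirac measure with mass $\Phi(r_0^+)-\Phi(r_0^-)$. $\Phi(0)$ means $\lim_{r\to0^+}\Phi(r)$. The Cauchy problem is understood as an ordinary differential equation in the Banach space $L^\infty(\mathbb R^d)$: $u\in C^1([0,\infty);L^\infty(\mathbb R^d))$. $|v|_{\mathrm{Lip}}=\sup_{\bm x\neq\bm y}|v(\bm x)-v(\bm y)|/|\bm x-\bm y|$ is the Lipschitz seminorm (of the Lipschitz representative). *)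

(* Defs.v *)
From HB Require Import structures.
From mathcomp Require Import all_boot all_order all_algebra.
From mathcomp Require Import lra.
From mathcomp Require Import all_classical all_reals all_analysis.

Set Implicit Arguments.
Unset Strict Implicit.
Unset Printing Implicit Defensive.
Import Order.TTheory GRing.Theory Num.Theory.
Import numFieldNormedType.Exports.
Local Open Scope classical_set_scope.
Local Open Scope ring_scope.

(* The space R^n is 'rV[R]_n.  The norm of the library on matrices is the max
   norm, so the Euclidean structure is introduced separately. *)

Section euclidean.
Context {R : realType} {n : nat}.
Implicit Types x y : 'rV[R]_n.

Definition edot x y : R := \sum_(i < n) x 0 i * y 0 i.

Definition enorm x : R := Num.sqrt (edot x x).

Definition lip_seminorm (v : 'rV[R]_n -> R) : \bar R :=
  ereal_sup [set (`|v p.1 - v p.2| / enorm (p.1 - p.2))%:E |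
             p in [set p : 'rV[R]_n * 'rV[R]_n | p.1 != p.2]].

End euclidean.

(* The sigma-algebra generated by the coordinates, i.e. the Borel one. *)

Definition rV_display : measure_display -> measure_display.
Proof. exact. Qed.

Section measurable_rV.
Context {R : realType} (n : nat).

Let coord : 'I_n -> 'rV[R]_n -> R := fun i x => x 0 i.

Let rV_set0 : g_sigma_preimage coord set0.
Proof. exact: sigma_algebra0. Qed.

Let rV_setC A : g_sigma_preimage coord A -> g_sigma_preimage coord (~` A).
Proof. exact: sigma_algebraC. Qed.

Let rV_bigcup (F : _^nat) : (forall i, g_sigma_preimage coord (F i)) ->
  g_sigma_preimage coord (\bigcup_i (F i)).
Proof. exact: sigma_algebra_bigcup. Qed.

HB.instance Definition _ := @isMeasurable.Build
  (rV_display default_measure_display) 'rV[R]_n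
  (g_sigma_preimage coord) rV_set0 rV_setC rV_bigcup.

End measurable_rV.

Lemma measurable_coord (R : realType) n (i : 'I_n) :
  measurable_fun [set: 'rV[R]_n] (fun x : 'rV[R]_n => x 0 i).
Proof.
move=> _ Y mY; rewrite setTI; apply: sub_sigma_algebra => /=.
rewrite -bigcup_seq/=; exists i => /=; first by rewrite mem_index_enum.
by exists Y => //; rewrite setTI.
Qed.

Lemma measurable_fun_rVP d (T : measurableType d) (R : realType) n
    (f : T -> 'rV[R]_n) :
  (forall i, measurable_fun [set: T] (fun t => f t 0 i)) ->
  measurable_fun [set: T] f.
Proof.
move=> mf; pose c i (x : 'rV[R]_n) : R := x 0 i.
suff : g_sigma_preimage (fun i => c i \o f) `<=` measurable.
  by rewrite g_sigma_preimage_comp => H _ A mA; apply: H; exists A.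
apply: smallest_sub; first exact: sigma_algebra_measurable.
case: n => [|n] in f mf c *; first by rewrite big_ord0.
rewrite -bigcup_mkord_ord; apply: bigcup_sub => i Ii.
by move=> A [B mB <-]; exact: mf.
Qed.

Section lebesgue_rV.
Context {R : realType}.

Definition rV_cons n (p : measurableTypeR R * 'rV[R]_n) : 'rV[R]_n.+1 :=
  row_mx (const_mx p.1 : 'rV[R]_1) p.2.

Definition rV_uncons n (z : 'rV[R]_n.+1) : measurableTypeR R * 'rV[R]_n :=
  (z 0 ord0, rsubmx (z : 'rV[R]_(1 + n))).

Lemma rV_consK n : cancel (@rV_cons n) (@rV_uncons n).
Proof.
case=> x y; rewrite /rV_uncons /rV_cons /=; congr pair; last first.
  exact: row_mxKr.
have -> : ord0 = lshift n (@ord0 0) by exact/val_inj.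
by apply: etrans (@row_mxEl _ _ _ _ _ y 0 ord0) _; rewrite mxE.
Qed.

Lemma measurable_rV_cons n : measurable_fun setT (@rV_cons n).
Proof.
apply: measurable_fun_rVP => i.
have [j ->|j ->] := @split_ordP 1 n i.
  rewrite (_ : (fun _ => _) = fst); first exact: measurable_fst.
  apply/funext => p.
  by apply: etrans (@row_mxEl _ _ _ _ (const_mx p.1) p.2 0 j) _; rewrite mxE.
rewrite (_ : (fun _ => _) = (fun x : 'rV[R]_n => x 0 j) \o snd).
  exact: (measurableT_comp (@measurable_coord R n j) measurable_snd).
by apply/funext => p; exact: (@row_mxEr _ _ _ _ (const_mx p.1) p.2 0 j).
Qed.

Lemma measurable_rV_uncons n : measurable_fun setT (@rV_uncons n).
Proof.
apply/measurable_fun_pairP; split; first exact: measurable_coord.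
apply: measurable_fun_rVP => i.
rewrite (_ : (fun _ => _) = fun z : 'rV[R]_n.+1 => z 0 (rshift 1 i)).
  exact: measurable_coord.
by apply/funext => z; rewrite /= mxE.
Qed.

Section lebesgue_rV_cons.
Context n (m : {sigma_finite_measure set 'rV[R]_n -> \bar R}).

Definition lebesgue_rV_cons :=
  pushforward (lebesgue_measure \x m)%E (@rV_cons n).

HB.instance Definition _ := Measure.copy lebesgue_rV_cons
  (measure_function_pushforward__canonical__measure_function_Measure
    (lebesgue_measure \x m)%E (@measurable_rV_cons n)).

Let sigma_finite_cons : sigma_finite setT lebesgue_rV_cons.
Proof.
have /sigma_finiteP[F [TF ndF Foo]] :=
  sigma_finiteT (@lebesgue_measure R : {sigma_finite_measure set _ -> \bar R}).
have /sigma_finiteP[G [TG ndG Goo]] := sigma_finiteT m.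
exists (fun k => @rV_uncons n @^-1` (F k `*` G k)).
  rewrite -preimage_bigcup (_ : \bigcup_k _ = setT) ?preimage_setT//.
  rewrite -setXTT TF TG predeqE => -[x y]; split.
    by move=> [k _ []/= ? ?]; split; exists k.
  move=> [/= [k _ Fkx] [l _ Gly]]; exists (maxn k l) => //; split.
  - by move: x Fkx; exact/subsetPset/ndF/leq_maxl.
  - by move: y Gly; exact/subsetPset/ndG/leq_maxr.
move=> k; have [mF Fk] := Foo k; have [mG Gk] := Goo k; split.
  rewrite -[X in measurable X]setTI; apply: measurable_rV_uncons => //.
  exact: measurableX.
rewrite /lebesgue_rV_cons /pushforward -comp_preimage.
rewrite (_ : _ \o _ = id); last by apply/funext => p; exact: rV_consK.
by rewrite preimage_id product_measure1E// lte_mul_pinfty// ge0_fin_numE.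
Qed.

HB.instance Definition _ := @Measure_isSigmaFinite.Build _ _ _
  lebesgue_rV_cons sigma_finite_cons.

End lebesgue_rV_cons.

Fixpoint lebesgue_rV n : {sigma_finite_measure set 'rV[R]_n -> \bar R} :=
  match n with
  | 0%N => [the {sigma_finite_measure set 'rV[R]_0 -> \bar R} of
         @dirac _ 'rV[R]_0 (0 : 'rV[R]_0) R]
  | n'.+1 => [the {sigma_finite_measure set 'rV[R]_n'.+1 -> \bar R} of
              lebesgue_rV_cons (lebesgue_rV n')]
  end.

End lebesgue_rV.

(* S^d as a subset of R^(d+1); indexing by d keeps the ambient dimension
   positive, so that the sphere is inhabited, as a measurableType must be. *)

Section sphere.
Context {R : realType} (d : nat).

Record sphere := Sphere {
  normal :> 'rV[R]_d.+1 ;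
  normalP : enorm normal == 1 }.

HB.instance Definition _ := [isSub for normal].
HB.instance Definition _ := [Choice of sphere by <:].

Lemma enorm_delta0 : enorm (delta_mx 0 0 : 'rV[R]_d.+1) == 1.
Proof.
rewrite /enorm /edot big_ord_recl big1 => [|i _]; last by rewrite !mxE mulr0.
by rewrite !mxE !eqxx mulr1 addr0 sqrtr1.
Qed.

HB.instance Definition _ := isPointed.Build sphere (Sphere enorm_delta0).

HB.instance Definition _ :=
  Measurable.copy sphere (g_sigma_algebra_preimageType normal).

(* Compactness of K : set sphere is that of its image in R^(d+1). *)
Definition radon (w : set sphere -> \bar R) : Prop :=
  (forall K, measurable K -> compact (normal @` K) -> (w K < +oo)%E) /\
  (forall A, measurable A ->
    w A = ereal_sup [set w K |
      K in [set K | [/\ measurable K, K `<=` A & compact (normal @` K)]]]).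

End sphere.
Arguments sphere : clear implicits.

Section averaging_filter.
Context {R : realType}.

(* Only the values on ]0, +oo[ matter. *)
Record averaging_filter := AveragingFilter {
  filter_fun :> R -> R ;
  filter_ge0 : forall r, 0 < r -> 0 <= filter_fun r ;
  filter_nonincreasing :
    forall r s, 0 < r -> r <= s -> filter_fun s <= filter_fun r ;
  filter_cvg0 : cvg (filter_fun r @[r --> 0^'+]) }.

Variable Phi : averaging_filter.

Definition filter_at0 : R := lim (Phi r @[r --> 0^'+]).

(* The right-continuous version of - Phi, extended by - Phi(0) to ]-oo, 0]:
   its Stieltjes measure is the opposite of the distributional derivative of
   Phi on ]0, +oo[ and does not charge ]-oo, 0]. *)
Definition opp_filter (r : R) : R := - lim (Phi s @[s --> (Num.max r 0)^'+]).

Lemma filter_le_at0 r : 0 < r -> Phi r <= filter_at0.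
Proof.
move=> r0; apply: limr_ge; first exact: filter_cvg0.
near=> s; apply: filter_nonincreasing => //.
by near: s; exact: nbhs_right_le.
Unshelve. all: by end_near. Qed.

Lemma filter_has_ubound r : has_ubound (Phi @` `]Num.max r 0, +oo[).
Proof.
exists filter_at0 => _ [s /= + <-]; rewrite in_itv/= andbT => rs.
by apply/filter_le_at0/(le_lt_trans _ rs); rewrite le_max lexx orbT.
Qed.

Lemma filter_has_sup r : has_sup (Phi @` `]Num.max r 0, +oo[).
Proof.
split; last exact: filter_has_ubound.
exists (Phi (Num.max r 0 + 1)), (Num.max r 0 + 1) => //=.
by rewrite in_itv/= andbT ltrDl.
Qed.

Lemma opp_filterE r : opp_filter r = - sup (Phi @` `]Num.max r 0, +oo[).
Proof.
rewrite /opp_filter; congr (- _).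
apply/cvg_lim => //.
apply: nonincreasing_at_right_cvgr (filter_has_ubound r) => // x y.
rewrite !in_itv/= !andbT => rx _ xy; apply: filter_nonincreasing => //.
by rewrite (le_lt_trans _ rx)// le_max lexx orbT.
Qed.

Lemma opp_filter_nd : {homo opp_filter : r s / r <= s}.
Proof.
move=> r s rs; rewrite !opp_filterE lerN2; apply: sup_le => //.
- move=> _ [t /= + <-]; rewrite in_itv/= andbT => st.
  exists (Phi t); split=> //; exists t => //=; rewrite in_itv/= andbT.
  by rewrite (le_lt_trans _ st)// ge_max !le_max rs lexx orbT.
- by have [] := filter_has_sup s.
- exact: filter_has_sup.
Qed.

Lemma opp_filter_rc : right_continuous opp_filter.
Proof.
move=> r; apply/cvgrPdist_le => e e0; rewrite opp_filterE.
have [_ [s /= + <-] sPhi] := sup_adherent e0 (filter_has_sup r).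
rewrite in_itv/= andbT gt_max => /andP[rs s0].
near=> t; have rt : r <= t by near: t; exact: nbhs_right_ge.
rewrite opp_filterE ler_norml opprK.
have tr : - sup (Phi @` `]Num.max r 0, +oo[) <=
          - sup (Phi @` `]Num.max t 0, +oo[).
  by rewrite -!opp_filterE; exact: opp_filter_nd.
have st : Phi s <= sup (Phi @` `]Num.max t 0, +oo[).
  apply: ub_le_sup; first exact: filter_has_ubound.
  exists s => //=; rewrite in_itv/= andbT gt_max s0 andbT.
  by near: t; exact: nbhs_right_lt.
by apply/andP; split; lra.
Unshelve. all: by end_near. Qed.

HB.instance Definition _ :=
  isCumulative.Build R _ R opp_filter opp_filter_nd opp_filter_rc.

Definition opp_filter_deriv : {measure set (measurableTypeR R) -> \bar R} :=
  lebesgue_stieltjes_measure opp_filter.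

End averaging_filter.
Arguments averaging_filter : clear implicits.

Section upwind_divergence.
Context {R : realType}.

Definition oriented_integral (f : R -> R) (u : R) : R :=
  if 0 <= u then \int[lebesgue_measure]_(s in `[0, u]) f s
  else - \int[lebesgue_measure]_(s in `[u, 0]) f s.

(* derive1 f takes the value 0 where f is not derivable, which for a locally
   Lipschitz f only happens on a null set. *)
Definition increasing_part (f : R -> R) : R -> R :=
  oriented_integral (fun s => Num.max 0 (derive1 f s)).

Definition decreasing_part (f : R -> R) : R -> R :=
  oriented_integral (fun s => Num.min 0 (derive1 f s)).

Definition flux_plus n (F : R -> 'rV[R]_n) (y : 'rV[R]_n) : R -> R :=
  increasing_part (fun u => edot (F u) y).

Definition flux_minus n (F : R -> 'rV[R]_n) (y : 'rV[R]_n) (u : R) : R :=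
  - decreasing_part (fun u => edot (F u) y) u.

(* div^Phi F(u)(x) in radial coordinates; the leading sign turns the positive
   measure opp_filter_deriv Phi into Phi'(r) dr. *)
Definition upwind_div d (Phi : averaging_filter R)
    (w : {measure set (sphere R d) -> \bar R}) (F : R -> 'rV[R]_d.+1)
    (u : 'rV[R]_d.+1 -> R) (x : 'rV[R]_d.+1) : R :=
  - \int[w]_n \int[opp_filter_deriv Phi]_(r in `]0, +oo[)
      (flux_plus F n (u x) - flux_plus F n (u (x + r *: normal n)) +
       flux_minus F n (u x) - flux_minus F n (u (x - r *: normal n))).

End upwind_divergence.

(* Elements of L^oo(R^n) are represented by essentially bounded Borel
   functions, up to almost everywhere equality. *)

Section Linfty_ode.
Context {R : realType} {n : nat}.
Implicit Types (f g : 'rV[R]_n -> R) (u v : R -> 'rV[R]_n -> R).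

Local Notation leb := (lebesgue_rV n : {measure set 'rV[R]_n -> \bar R}).

Definition Linfty f : Prop := f \in Lfun leb +oo%E.

Definition Linfty_norm f : \bar R := ('N[leb]_+oo[EFin \o f])%E.

Definition ae_equal f g : Prop := f = g %[ae leb].

Definition Linfty_continuous u : Prop :=
  forall t, 0 <= t ->
    Linfty_norm (u s \- u t) @[s --> within [set s | 0 <= s] (nbhs t)] --> 0%E.

(* v is the derivative of u : [0, +oo[ -> L^oo, one-sided at 0. *)
Definition Linfty_derivative u v : Prop :=
  forall t, 0 <= t ->
    Linfty_norm ((s - t)^-1 \*: (u s \- u t) \- v t)
      @[s --> within [set s | 0 <= s] t^'] --> 0%E.

Definition C1_solution (A : ('rV[R]_n -> R) -> ('rV[R]_n -> R))
    (u0 : 'rV[R]_n -> R) u : Prop :=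
  [/\ forall t, 0 <= t -> Linfty (u t),
      ae_equal (u 0) u0 &
      exists u' : R -> 'rV[R]_n -> R,
        [/\ forall t, 0 <= t -> Linfty (u' t),
            Linfty_derivative u u',
            Linfty_continuous u' &
            forall t, 0 <= t -> ae_equal (u' t) (A (u t))]].

End Linfty_ode.

(* Main.v *)
From HB Require Import structures.
Require Import Defs.
From mathcomp Require Import all_boot all_order all_algebra.
From mathcomp Require Import lra ring.
From mathcomp Require Import all_classical all_reals all_analysis.
From mathcomp Require Import measurable_realfun ess_sup_inf.
Set Implicit Arguments.
Unset Strict Implicit.
Unset Printing Implicit Defensive.
Import Order.TTheory GRing.Theory Num.Theory.
Import numFieldNormedType.Exports.
Local Open Scope classical_set_scope.
Local Open Scope ring_scope.

(* The operator A = div^Phi F is Lipschitz with constant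
   C = 4 L w(S^d) Phi(0), since both parts of the flux are L-Lipschitz in u and
   - Phi'(r) dr has mass at most Phi(0).  The estimate holds pointwise and
   across translations: |A u (x) - A v (y)| <= C K as soon as
   |u(x + h) - v(y + h)| <= K for all h.  Starting from an everywhere bounded
   Borel representative, Picard iteration with pointwise time integrals thus
   converges in the sup norm, and the Lipschitz bound is inherited from the
   iterates.  By Tonelli and the translation invariance of null sets, A respects
   almost everywhere equality; uniqueness in L^oo is then Gronwall's lemma for
   t |-> |v(t) - u(t)|_oo. *)

(** * Integrals of bounded functions *)

(** The integrals in [upwind_div] read u along the rays x + r n and x - r n, and [opp_filter_deriv]
    may have atoms, so a class modulo null sets cannot be evaluated there directly. Estimates are
    therefore made at every point, for bounded Borel functions, and null sets return mainly in the
    uniqueness argument. Time integrals taken point by point avoid integrating L^oo-valued curves;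
    the price is joint measurability of every iterate in (t, x), hence of the flux in (u, n), hence
    of the derivative of s |-> F(s).n in (n, s). The preliminaries build this chain. The factor 4 of
    C counts the flux values in the integrand, and finiteness of w(S^d) comes from the trace of the
    isotropy condition. Two exponential rates coexist: convergence uses a weight growing faster than
    exp(C t), whereas the bounds inherited by the limit are proved with the rate C itself, which
    gives the stated exponent. The Lipschitz bound for an arbitrary solution comes, by uniqueness,
    from the solution constructed from a truncated Lipschitz representative. *)

Lemma bounded_integrable d (T : measurableType d) (R : realType)
    (mu : {measure set T -> \bar R}) (D : set T) (f : T -> R) (K : R) :
  measurable D -> (mu D < +oo)%E -> measurable_fun D f ->
  (forall x, D x -> `|f x| <= K) -> mu.-integrable D (EFin \o f).
Proof.
move=> mD muD mf fK; apply: measurable_bounded_integrable => //.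
exists K; split; first by rewrite num_real.
by move=> M KM x Dx; apply: le_trans (fK x Dx) (ltW KM).
Qed.

Lemma normr_Rintegral_le d (T : measurableType d) (R : realType)
    (mu : {measure set T -> \bar R}) (D : set T) (f : T -> R) (K : R) :
  measurable D -> (mu D < +oo)%E -> measurable_fun D f ->
  (forall x, D x -> `|f x| <= K) ->
  `|\int[mu]_(x in D) f x| <= K * fine (mu D).
Proof.
move=> mD muD mf fK; have fi := bounded_integrable mD muD mf fK.
apply: le_trans (le_normr_Rintegral mD fi) _.
rewrite -Rintegral_cst//; apply: le_Rintegral => //.
- by have := integrable_norm fi.
- by apply: (@bounded_integrable _ _ _ _ _ (cst K) `|K|).
Qed.

Lemma normr_RintegralB_le d (T : measurableType d) (R : realType)
    (mu : {measure set T -> \bar R}) (D : set T) (f g : T -> R) (K Kf Kg : R) :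
  measurable D -> (mu D < +oo)%E ->
  measurable_fun D f -> measurable_fun D g ->
  (forall x, D x -> `|f x| <= Kf) -> (forall x, D x -> `|g x| <= Kg) ->
  (forall x, D x -> `|f x - g x| <= K) ->
  `|\int[mu]_(x in D) f x - \int[mu]_(x in D) g x| <= K * fine (mu D).
Proof.
move=> mD muD mf mg fK gK fgK.
rewrite -RintegralB//; last 2 first.
- exact: bounded_integrable fK.
- exact: bounded_integrable gK.
by apply: normr_Rintegral_le => //; exact: measurable_funB.
Qed.

Section sigma_finite_copy.
Context d (T : measurableType d) (R : realType)
  (mu : {measure set T -> \bar R}) (sf : sigma_finite setT mu).

(* [mu] with its sigma-finiteness attached, so that Fubini applies to it. *)
Definition sigma_finite_copy of sigma_finite setT mu : set T -> \bar R := mu.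

HB.instance Definition _ := Measure.on (sigma_finite_copy sf).

HB.instance Definition _ :=
  @Measure_isSigmaFinite.Build _ _ _ (sigma_finite_copy sf) sf.

End sigma_finite_copy.

(** Tonelli is applied to the positive and negative parts separately, and [fine] of the difference
    is measurable even where both integrals are infinite. The domain [D] is absorbed into an
    indicator. *)
Lemma measurable_fun_Rintegral d1 d2 (T1 : measurableType d1)
    (T2 : measurableType d2) (R : realType)
    (mu : {measure set T2 -> \bar R}) (D : set T2) (f : T1 * T2 -> R) :
  sigma_finite setT mu -> measurable D -> measurable_fun setT f ->
  measurable_fun setT (fun x => \int[mu]_(y in D) f (x, y)).
Proof.
move=> sf mD mf.
pose m := sigma_finite_copy sf.
pose g (p : T1 * T2) : \bar R := (f p * \1_D p.2)%:E.
have mg : measurable_fun setT g.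
  apply/measurable_EFinP/measurable_funM => //.
  by apply: measurableT_comp => //; exact: measurable_indic.
rewrite (_ : (fun x => _) = fine \o
    ((fun x => \int[m]_y g^\+ (x, y)) \- (fun x => \int[m]_y g^\- (x, y)))%E).
  apply: measurableT_comp => //.
  apply: emeasurable_funB.
    by apply: measurable_fun_fubini_tonelli_F => //; exact: measurable_funepos.
  by apply: measurable_fun_fubini_tonelli_F => //; exact: measurable_funeneg.
apply/funext => x; rewrite /Rintegral /=; congr fine.
transitivity (\int[m]_y g (x, y))%E.
  rewrite integral_mkcond; apply: eq_integral => y _.
  by rewrite patchE /g indicE; case: ifPn; rewrite ?mulr1 ?mulr0.
rewrite integralE; under eq_integral do rewrite funepos_comp/=.
by under [X in (_ - X)%E = _]eq_integral do rewrite funeneg_comp/=.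
Qed.

Lemma ae_eq_Rintegral d (T : measurableType d) (R : realType)
    (mu : {measure set T -> \bar R}) (D : set T) (f g : T -> R) :
  measurable D -> measurable_fun D f -> measurable_fun D g ->
  ae_eq mu D f g -> \int[mu]_(x in D) f x = \int[mu]_(x in D) g x.
Proof.
move=> mD mf mg fg; congr fine; apply: ae_eq_integral => //.
- exact/measurable_EFinP.
- exact/measurable_EFinP.
- by apply: filterS fg => x /[apply] ->.
Qed.

(** * Joint measurability *)

(** Rounding down to the grid of mesh 1 / (k + 1) gives the countably valued approximations of the
    first variable in [measurable_fun_caratheodory]. *)
Lemma floor_div_cvg (R : realType) (c : R) :
  (Num.floor (c * k.+1%:R))%:~R / k.+1%:R @[k --> \oo] --> c.
Proof.
apply/cvgrPdist_le => e e0; near=> k.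
have k0 : 0 < k.+1%:R :> R by rewrite ltr0n.
have /andP[l u] := floor_itv (c * k.+1%:R).
rewrite intrD in u.
have ke : k.+1%:R^-1 <= e.
  by apply: ltW; near: k; exact: (near_infty_natSinv_lt (PosNum e0)).
set z := _%:~R in l u *.
have -> : c - z / k.+1%:R = (c * k.+1%:R - z) / k.+1%:R.
  by rewrite mulrBl mulfK// gt_eqF.
rewrite ger0_norm; last by rewrite mulr_ge0 ?subr_ge0 ?invr_ge0// ltW.
apply: le_trans ke; rewrite ler_pdivrMr// mulVf ?gt_eqF//.
by rewrite lerBlDl ltW.
Unshelve. all: by end_near. Qed.

(** Rounding the first variable to a grid makes preimages countable unions of rectangles; continuity
    in that variable makes f the pointwise limit of these functions. *)
Lemma measurable_fun_caratheodory d (T : measurableType d) (R : realType)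
    (f : measurableTypeR R * T -> R) :
  (forall c, measurable_fun setT (fun t => f (c, t))) ->
  (forall t, continuous (fun c : R => f (c, t))) ->
  measurable_fun setT f.
Proof.
move=> mf cf.
pose q k (c : R) : R := (Num.floor (c * k.+1%:R))%:~R / k.+1%:R.
apply: (@measurable_fun_cvg _ _ _ _ (fun k p => f (q k p.1, p.2))).
- move=> k _ B mB; rewrite setTI.
  rewrite (_ : _ @^-1` _ = \bigcup_(z : int)
    ([set c : measurableTypeR R | Num.floor (c * k.+1%:R) = z] `*`
     ((fun t => f (z%:~R / k.+1%:R, t)) @^-1` B))).
    apply: countable_bigcupT_measurable => // z.
    apply: measurableX; last by rewrite -[X in measurable X]setTI; exact: mf.
    rewrite (_ : [set _ | _] =
       `[z%:~R / k.+1%:R, (z + 1)%:~R / k.+1%:R[%classic).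
      exact: measurable_itv.
    apply/seteqP; split => c /=.
      move=> <-; rewrite in_itv /= ler_pdivrMr// ltr_pdivlMr//.
      exact: floor_itv.
    rewrite in_itv /= ler_pdivrMr// ltr_pdivlMr// => h.
    exact: floor_def.
  apply/seteqP; split => -[c t] /=; last by move=> [z _ [/= <-]].
  by move=> h; exists (Num.floor (c * k.+1%:R)).
- move=> [c t] _ /=.
  exact: (cvg_comp _ _ (@floor_div_cvg R c) (cf t c)).
Qed.

Lemma lipschitz_continuous (R : realType) (f : R -> R) (L : R) :
  (forall a b, `|f a - f b| <= L * `|a - b|) -> continuous f.
Proof.
move=> fL c; apply/cvgrPdist_le => e e0; near=> s.
apply: le_trans (fL _ _) _.
apply: (@le_trans _ _ ((`|L| + 1) * `|c - s|)).
  by rewrite ler_wpM2r// (le_trans (ler_norm _))// lerDl.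
rewrite -ler_pdivlMl ?ltr_wpDl//.
near: s; apply: (@cvgr_dist_le _ _ _ _ _ (fun s : R => s) c) => //.
by rewrite mulr_gt0// invr_gt0 ltr_wpDl.
Unshelve. all: by end_near. Qed.

(** * Null sets in products and translations *)

(** The product measure is the integral of the measures of the sections, and a non-negative function
    has integral zero exactly when it vanishes almost everywhere. *)
Lemma product_measure_null d1 d2 (T1 : measurableType d1)
    (T2 : measurableType d2) (R : realType)
    (m1 : {measure set T1 -> \bar R})
    (m2 : {sigma_finite_measure set T2 -> \bar R}) (E : set (T1 * T2)) :
  measurable E ->
  (m1 \x m2)%E E = 0%E <-> {ae m1, forall x, m2 (xsection E x) = 0%E}.
Proof.
move=> mE; have mf := measurable_fun_xsection m2 mE.
have := ae_eq_integral_abs m1 measurableT mf.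
rewrite (eq_integral (m2 \o xsection E)); last first.
  by move=> x _; rewrite gee0_abs.
move=> [h1 h2]; split => h.
- by apply: filterS (h1 h) => x /(_ I).
- by apply: h2; apply: filterS h => x /= h _.
Qed.

(** Integrating in the other order shows that E is null for the product. This exchanges quantifiers:
    from every y having few bad x to almost every x having few bad y. *)
Lemma ae_xsection_null d1 d2 (T1 : measurableType d1)
    (T2 : measurableType d2) (R : realType)
    (m1 : {sigma_finite_measure set T1 -> \bar R})
    (m2 : {sigma_finite_measure set T2 -> \bar R}) (E : set (T1 * T2)) :
  measurable E -> (forall y, m1 (ysection E y) = 0%E) ->
  {ae m1, forall x, m2 (xsection E x) = 0%E}.
Proof.
move=> mE E0; apply/product_measure_null => //.
rewrite (product_measure_unique (m' := (m1 \x^ m2)%E))//; last first.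
  by move=> A B mA mB; exact: product_measure2E.
by apply: (@integral0_eq _ _ _ m2 _ (m1 \o ysection E)) => y _; exact: E0.
Qed.

Lemma ae_xsection2_null d1 d2 d3 (T1 : measurableType d1)
    (T2 : measurableType d2) (T3 : measurableType d3) (R : realType)
    (m1 : {sigma_finite_measure set T1 -> \bar R})
    (m2 : {sigma_finite_measure set T2 -> \bar R})
    (m3 : {sigma_finite_measure set T3 -> \bar R}) (E : set (T1 * (T2 * T3))) :
  measurable E -> (forall q, m1 (ysection E q) = 0%E) ->
  {ae m1, forall x, {ae m2, forall y, m3 (xsection (xsection E x) y) = 0%E}}.
Proof.
(* The canonical sigma-finite structure of [m2 \x m3] is masked by the one of
   products of subprobabilities. *)
move=> mE E0; have sf23 : sigma_finite setT (m2 \x m3)%E.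
  exact: lebesgue_integral_fubini.product_measure_sigma_finite_subproof.
have := ae_xsection_null (sigma_finite_copy sf23) mE E0.
apply: filterS => x h.
by apply/(product_measure_null m2 m3 (measurable_xsection x mE)); exact: h.
Qed.

(** The pushforward by the translation gives half-open intervals their length, which characterizes
    Lebesgue measure. *)
Lemma lebesgue_measure_translation (R : realType) (a : R)
    (A : set (measurableTypeR R)) : measurable A ->
  lebesgue_measure ((fun x : measurableTypeR R => x + a) @^-1` A) =
  lebesgue_measure A.
Proof.
move=> mA; pose sh (x : measurableTypeR R) : measurableTypeR R := x + a.
have ms : measurable_fun setT sh.
  exact: measurable_funD.
pose mu := measure_function_pushforward__canonical__measure_function_Measure
  (@lebesgue_measure R) ms.
apply/esym.
rewrite (@lebesgue_measure_unique R mu)// => _ [[x y] _ <-] /=.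
rewrite /mu /= /pushforward.
rewrite (_ : _ @^-1` _ = `]x - a, y - a]%classic).
  rewrite !lebesgue_measure_itv/= !lte_fin ltrD2r; case: ifPn => // _.
  by rewrite -!EFinB; congr (_%:E); ring.
by apply/seteqP; split => z /=; rewrite !in_itv/= ltrBlDr lerBrDr.
Qed.

Lemma measurable_rV_translation (R : realType) n (h : 'rV[R]_n) :
  measurable_fun setT (fun x : 'rV[R]_n => x + h).
Proof.
apply: measurable_fun_rVP => i; under eq_fun do rewrite mxE.
by apply: measurable_funD => //; exact: measurable_coord.
Qed.

Lemma rV_cons_lshift (R : realType) n (p : measurableTypeR R * 'rV[R]_n)
    (j : 'I_1) :
  rV_cons p 0 (lshift n j : 'I_n.+1) = p.1.
Proof. by apply: etrans (@row_mxEl _ _ _ _ _ p.2 0 j) _; rewrite mxE. Qed.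

Lemma rV_cons_rshift (R : realType) n (p : measurableTypeR R * 'rV[R]_n) j :
  rV_cons p 0 (rshift 1 j : 'I_n.+1) = p.2 0 j.
Proof. exact: (@row_mxEr _ _ _ _ (const_mx p.1) p.2 0 j). Qed.

Lemma rV_consD (R : realType) n (p q : measurableTypeR R * 'rV[R]_n) :
  rV_cons p + rV_cons q = rV_cons (p.1 + q.1, p.2 + q.2).
Proof.
apply/rowP => i; rewrite mxE; have [j ->|j ->] := @split_ordP 1 n i.
  by rewrite !rV_cons_lshift.
by rewrite !rV_cons_rshift mxE.
Qed.

Lemma rV_unconsK (R : realType) n : cancel (@rV_uncons R n) (@rV_cons R n).
Proof.
move=> x; apply/rowP => i; have [j ->|j ->] := @split_ordP 1 n i.
  rewrite rV_cons_lshift/=; congr (x _ _); apply/val_inj => /=.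
  by rewrite (ord1 j).
by rewrite rV_cons_rshift mxE.
Qed.

(** Induction on the dimension, splitting off the first coordinate: the sections of a translate are
    translates of sections, null by induction, and the exceptional first coordinates are shifted by
    the one-dimensional invariance. *)
Lemma lebesgue_rV_translation_null (R : realType) n (h : 'rV[R]_n)
    (A : set 'rV[R]_n) :
  measurable A -> lebesgue_rV n A = 0%E ->
  lebesgue_rV n ((fun x => x + h) @^-1` A) = 0%E.
Proof.
elim: n h A => [|n IH] h A mA A0.
  by rewrite (_ : _ @^-1` A = A)//; apply/seteqP; split => x /=;
    rewrite (_ : x + h = x)//; apply/rowP => -[].
have mcons B : measurable B -> measurable (@rV_cons R n @^-1` B).
  by move=> mB; rewrite -[X in measurable X]setTI; exact: measurable_rV_cons.
have mAh : measurable ((fun x => x + h) @^-1` A).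
  by rewrite -[X in measurable X]setTI; exact: measurable_rV_translation.
have {A0} := A0; rewrite /= /lebesgue_rV_cons /pushforward.
move/(product_measure_null _ _ (mcons _ mA)) => [N [mN N0 AN]].
apply/product_measure_null; first exact: mcons.
pose h' := rsubmx (h : 'rV[R]_(1 + n)).
exists ((fun x : measurableTypeR R => x + h 0 ord0) @^-1` N); split.
- by rewrite -[X in measurable X]setTI; exact: measurable_funD.
- exact: etrans (lebesgue_measure_translation _ mN) N0.
move=> s /= Ns; apply: AN => /= As; apply: Ns.
rewrite (_ : xsection _ s = (fun y => y + h') @^-1`
    xsection (@rV_cons R n @^-1` A) (s + h 0 ord0)); last first.
  have hE y : rV_cons (s, y) + h = rV_cons (s + h 0 ord0, y + h').
    by rewrite -[in LHS](rV_unconsK h) rV_consD.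
  by apply/seteqP; split => y; rewrite /xsection /= !inE /= hE.
by apply: IH => //; apply: measurable_xsection; exact: mcons.
Qed.

(** * Euclidean structure and Lipschitz functions *)

(** Positivity selects the essential supremum in the definition of the norm of exponent +oo, and
    yields a point outside any given null set. *)
Lemma lebesgue_rV_setT_gt0 (R : realType) n :
  (0 < lebesgue_rV n [set: 'rV[R]_n])%E.
Proof.
elim: n => [|n IH].
  by rewrite /= diracT lte01.
rewrite /= /lebesgue_rV_cons /pushforward preimage_setT -setXTT.
rewrite product_measure1E//.
have Roo : lebesgue_measure [set: R] = +oo%E.
  by rewrite -set_itvNyy lebesgue_measure_itv.
by apply: mule_gt0 => //; rewrite [X in (0 < X)%E]Roo.
Qed.

Section edot_lemmas.
Context {R : realType} {n : nat}.
Implicit Types x y z : 'rV[R]_n.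

Lemma edot_ge0 x : 0 <= edot x x.
Proof. by apply: sumr_ge0 => i _; rewrite -expr2 sqr_ge0. Qed.

Lemma enorm_ge0 x : 0 <= enorm x. Proof. exact: sqrtr_ge0. Qed.

Lemma edotC x y : edot x y = edot y x.
Proof. by apply: eq_bigr => i _; rewrite mulrC. Qed.

Lemma edotBl x y z : edot (x - y) z = edot x z - edot y z.
Proof.
by rewrite /edot -sumrB; apply: eq_bigr => i _; rewrite !mxE mulrBl.
Qed.

Lemma edot_eq0 x : edot x x = 0 -> x = 0.
Proof.
move=> /eqP; rewrite psumr_eq0 => [|i _]; last by rewrite -expr2 sqr_ge0.
move=> /allP h; apply/rowP => i; rewrite mxE; apply/eqP.
by have := h i; rewrite mem_index_enum mulf_eq0 orbb; apply.
Qed.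

Lemma enorm0 : enorm (0 : 'rV[R]_n) = 0.
Proof. by rewrite /enorm /edot big1 ?sqrtr0// => i _; rewrite mxE mulr0. Qed.

Lemma enorm_eq0 x : enorm x = 0 -> x = 0.
Proof.
move=> /eqP; rewrite sqrtr_eq0 => x0; apply: edot_eq0.
by apply/eqP; rewrite eq_le x0 edot_ge0.
Qed.

Lemma cauchy_schwarz x y : `|edot x y| <= enorm x * enorm y.
Proof.
have exp s t : edot (s *: x + t *: y) (s *: x + t *: y) =
    s ^+ 2 * edot x x + 2 * s * t * edot x y + t ^+ 2 * edot y y.
  rewrite /edot !mulr_sumr -!big_split /=; apply: eq_bigr => i _.
  by rewrite !mxE; ring.
rewrite -sqrtrM ?edot_ge0// -sqrtr_sqr ler_wsqrtr//.
have [yy0|yy0] := eqVneq (edot y y) 0.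
  rewrite (edot_eq0 yy0) /edot big1 ?expr0n/= => [|i _]; last first.
    by rewrite mxE mulr0.
  by rewrite mulr_ge0// ?edot_ge0//; apply: sumr_ge0 => i _; rewrite mxE mulr0.
have yy : 0 < edot y y by rewrite lt_def yy0 edot_ge0.
(* This vector has squared norm (y.y) ((x.x) (y.y) - (x.y)^2). *)
have := edot_ge0 (edot y y *: x + (- edot x y) *: y).
rewrite exp => h; rewrite -(ler_pM2r yy) -subr_ge0.
by apply: le_trans h _; rewrite le_eqVlt; apply/orP; left; apply/eqP; ring.
Qed.

End edot_lemmas.

Lemma edot_rV_consB (R : realType) n (p q : measurableTypeR R * 'rV[R]_n) :
  edot (rV_cons p - rV_cons q) (rV_cons p - rV_cons q) =
  (p.1 - q.1) ^+ 2 + edot (p.2 - q.2) (p.2 - q.2).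
Proof.
have mxB m (x y : 'rV[R]_m) i : (x - y) 0 i = x 0 i - y 0 i by rewrite !mxE.
rewrite /edot expr2; apply: etrans (@big_split_ord _ _ _ 1 n _ _) _.
rewrite big_ord1 /=; congr (_ + _); last apply: eq_bigr => i _.
  by rewrite !mxB !rV_cons_lshift.
by rewrite !mxB !rV_cons_rshift.
Qed.

(** The sigma-algebra is generated by the coordinates, so they are split off one at a time: g is
    continuous in the first and, by induction, measurable in the others. *)
Lemma lipschitz_measurable_rV (R : realType) n (g : 'rV[R]_n -> R) (K : R) :
  (forall x y, `|g x - g y| <= K * enorm (x - y)) -> measurable_fun setT g.
Proof.
elim: n g => [|n IH] g gK.
  rewrite (_ : g = cst (g 0)); first exact: measurable_cst.
  by apply/funext => x; congr g; apply/rowP => -[].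
rewrite (_ : g = (g \o @rV_cons R n) \o @rV_uncons R n); last first.
  by apply/funext => x /=; rewrite rV_unconsK.
apply: measurableT_comp; last exact: measurable_rV_uncons.
apply: measurable_fun_caratheodory => [c|y c] /=.
  apply: IH => x y; apply: le_trans (gK _ _) _.
  by rewrite /enorm edot_rV_consB /= subrr expr0n /= add0r.
apply: (@lipschitz_continuous _ _ K) => a b; apply: le_trans (gK _ _) _.
rewrite /enorm edot_rV_consB /= subrr /edot big1 => [|i _]; last first.
  by rewrite mxE mulr0.
by rewrite addr0 sqrtr_sqr.
Qed.

(** * Measurability of the derivative *)

Lemma nbhs_rat (R : realType) (x : R) (P : set R) :
  nbhs x P -> exists q : rat, P (ratr q).
Proof.
move=> /nbhs_ballP[e /= e0 xeP].
have /rat_in_itvoo[q] : x - e < x + e by lra.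
rewrite in_itv /= => /andP[h1 h2]; exists q; apply: xeP.
by rewrite /ball /= ltr_norml; apply/andP; split; lra.
Qed.

Section derive1_measurable.
Context {R : realType}.
Implicit Types (f : R -> R) (s h : R).

Let quot f s h : R := h^-1 * (f (h + s) - f s).

Let derive1E f s : derive1 f s = lim (quot f s h @[h --> 0^']).
Proof. by []. Qed.

(* As f is continuous, rational increments suffice to decide whether the
   difference quotients converge: the points of differentiability thus form a
   countable combination of measurable sets. *)
Let derivable_approx f s m (c : rat) N := forall h : rat,
  0 < `|ratr h : R| < N.+1%:R^-1 ->
  `|quot f s (ratr h) - ratr c| <= m.+1%:R^-1.

Let cvg_quotP f s : continuous f ->
  cvg (quot f s h @[h --> 0^']) <->
  forall m, exists c N, derivable_approx f s m c N.
Proof.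
move=> cf; split.
  move=> /cvg_ex[l /= fl] m.
  have m0 : 0 < (m.+1%:R^-1 : R) / 2 by rewrite divr_gt0.
  have [c cl] := nbhs_rat (nbhsx_ballx l _ m0); exists c.
  move/cvgrPdist_lt : (fl) => /(_ _ m0).
  rewrite /dnbhs near_withinE => /nbhs_ballP[d /= d0 dq].
  have [N _ Nd] := near_infty_natSinv_lt (PosNum d0).
  exists N => h /andP[h0 hN].
  have := dq (ratr h); rewrite /ball /= sub0r normrN => ql.
  have {}ql : `|l - quot f s (ratr h)| < m.+1%:R^-1 / 2.
    by apply: ql; [exact: lt_trans hN (Nd N (leqnn N))|rewrite -normr_gt0].
  move: cl; rewrite /ball/= => cl.
  apply: ltW; rewrite [ltRHS]splitr.
  rewrite (_ : _ - _ = (l - ratr c) - (l - quot f s (ratr h))); last by ring.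
  by apply: le_lt_trans (ler_normB _ _) _; exact: ltrD.
move=> H; apply/cauchy_cvgP; apply: cauchy_exP => e e0.
have [m _ me] := near_infty_natSinv_lt (PosNum e0).
have [c [N cN]] := H m; exists (ratr c).
rewrite /nbhs /=.
have N0 : 0 < (N.+1%:R^-1 : R) by rewrite invr_gt0.
near=> h.
have h0 : h != 0 by near: h; exact: nbhs_dnbhs_neq.
have hN : `|h| < N.+1%:R^-1.
  by near: h; exact: dnbhs0_lt.
rewrite /ball /= distrC; apply: le_lt_trans (me m (leqnn m)).
(* The quotient is continuous at h, which is nonzero, so a real increment violating the bound would
   have a rational neighbour violating it as well. *)
rewrite leNgt; apply/negP => hm.
have cq : {for h, continuous (fun h => `|quot f s h - ratr c|)}.
  apply: cvg_norm; apply: cvgB; last exact: cvg_cst.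
  apply: cvgM; first exact: cvgV.
  apply: cvgB; last exact: cvg_cst.
  have hs : h + s @[h --> h] --> h + s.
    by apply: cvgD; [exact: cvg_id|exact: cvg_cst].
  exact: (cvg_comp _ _ hs (cf (h + s))).
have [k [[km k0] kN]] : exists k : rat,
    [/\ m.+1%:R^-1 < `|quot f s (ratr k) - ratr c|,
        ratr k != 0 :> R & `|ratr k : R| < N.+1%:R^-1].
  apply: (@nbhs_rat _ h (fun k => [/\ m.+1%:R^-1 < `|quot f s k - ratr c|,
        k != 0 & `|k| < N.+1%:R^-1])).
  near=> k; split.
  - by near: k; apply: (cvgr_gt _ cq).
  - by near: k; apply: (@cvgr_neq0 _ _ _ _ _ id) h0; exact: cvg_id.
  - by near: k; apply: (@cvgr_norm_lt _ _ _ _ _ id) hN; exact: cvg_id.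
have := cN k; rewrite normr_gt0 k0 kN => /(_ isT).
by rewrite leNgt km.
Unshelve. all: by end_near. Qed.


(** The set [D] of differentiability is measurable by the rational criterion, and the derivative is
    the pointwise limit of the quotients with increments 1 / (j + 1) cut off outside [D]. *)
Lemma measurable_fun_derive1 d (T : measurableType d)
    (G : T * measurableTypeR R -> R) :
  measurable_fun setT G -> (forall t, continuous (fun s : R => G (t, s))) ->
  measurable_fun setT (fun p => derive1 (fun s : R => G (p.1, s)) p.2).
Proof.
move=> mG cG.
pose q h (p : T * measurableTypeR R) := quot (fun s => G (p.1, s)) p.2 h.
have mq h : measurable_fun setT (q h).
  apply: measurable_funM => //; apply: measurable_funB => /=.
    apply: measurableT_comp => //; apply: measurable_fun_pair => //=.
    exact: measurable_funD.
  by rewrite (_ : (fun p => _) = G)//; apply/funext => -[].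
pose A m (c : rat) N : set (T * measurableTypeR R) :=
  [set p | derivable_approx (fun s => G (p.1, s)) p.2 m c N].
have mA m c N : measurable (A m c N).
  pose f k p := `|q (ratr k) p - ratr c|.
  rewrite (_ : A m c N = ~` \bigcup_(k : rat)
      (if 0 < `|ratr k : R| < N.+1%:R^-1
       then f k @^-1` `]m.+1%:R^-1, +oo[ else set0)); last first.
    apply/seteqP; split => p /= Ap.
      move=> [k _]; case: ifPn => // /Ap /=.
      by rewrite in_itv/= andbT ltNge => ->.
    move=> k kN; rewrite leNgt; apply/negP => kp; apply: Ap.
    by exists k => //; rewrite kN /= in_itv/= andbT.
  apply/measurableC/bigcupT_measurable_rat => k; case: ifPn => // _.
  rewrite -[X in measurable X]setTI.
  have mf : measurable_fun setT (f k).
    apply: (@measurableT_comp _ _ _ _ _ _ (@Num.norm R R) _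
      (fun p => q (ratr k) p - ratr c)) => //.
    by apply: measurable_funB; first exact: mq.
  by apply: mf => //; exact: measurable_itv.
pose D := \bigcap_m \bigcup_c \bigcup_N A m c N.
have mD : measurable D.
  apply: bigcapT_measurable => m; apply: bigcupT_measurable_rat => c.
  by apply: bigcupT_measurable => N.
have DP p : D p <-> cvg (q h p @[h --> 0^']).
  split.
    move=> Dp; apply/cvg_quotP; first exact: cG.
    by move=> m; have [c _ [N _ AN]] := Dp m I; exists c, N.
  move=> /cvg_quotP -/(_ (cG _)) H m _; have [c [N AN]] := H m.
  by exists c => //; exists N.
apply: (@measurable_fun_cvg _ _ _ _ (fun j p => q j.+1%:R^-1 p * \1_D p)).
  by move=> j; apply: measurable_funM => //; exact: measurable_indic.
move=> p _; rewrite indicE derive1E.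
have [Dp|nDp] := pselect (D p).
  rewrite mem_set//; under eq_fun do rewrite mulr1.
  have hj : (j.+1%:R^-1 : R) @[j --> \oo] --> 0^'.
    move=> P P0; change (\forall j \near \oo, P (j.+1%:R^-1 : R)).
    have : \forall j \near \oo, harmonic j != 0 :> R -> P (harmonic j).
      exact: (@cvg_harmonic R _ P0).
    by apply: filterS => j; apply; exact: lt0r_neq0 (harmonic_gt0 _).
  exact: (cvg_comp _ _ hj (iffLR (DP p) Dp)).
(* Outside [D] the limit defining the derivative takes its default value 0, in agreement with the
   cut-off quotients. *)
rewrite memNset//; under eq_fun do rewrite mulr0.
rewrite dvgP; last by move=> /DP.
exact: cvg_cst.
Qed.

End derive1_measurable.

(** * Increasing and decreasing parts of the flux *)

Lemma normr_derive1_le (R : realType) (f : R -> R) (L s : R) :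
  (forall a b, `|f a - f b| <= L * `|a - b|) -> `|derive1 f s| <= L.
Proof.
move=> fL; rewrite /derive1; set q := (fun h => _).
have [cq|ncq] := pselect (cvg (q h @[h --> 0^'])); last first.
  (* Without a limit the derivative has the default value 0; the Lipschitz bound between 1 and 0
     supplies 0 <= L. *)
  rewrite dvgP//; have := fL 1 0; rewrite subr0 normr1 mulr1.
  by rewrite [X in _ -> X <= _](_ : _ = 0); [exact: le_trans|exact: normr0].
have qn : `|q h| @[h --> 0^'] --> `|lim (q h @[h --> 0^'])|.
  exact: cvg_norm.
apply: (cvgr_to_le qn); near=> h.
have h0 : h != 0 by near: h; exact: nbhs_dnbhs_neq.
rewrite /q /GRing.scale /= normrM normfV mulrC ler_pdivrMr ?normr_gt0//.
by have := fL (h + s) s; rewrite addrK.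
Unshelve. all: by end_near. Qed.

Lemma lebesgue_measure_itvcc (R : realType) (a b : R) : a <= b ->
  lebesgue_measure `[a, b]%classic = (b - a)%:E.
Proof.
move=> ab; rewrite lebesgue_measure_itv/= lte_fin EFinB; case: ltP => //= ba.
by rewrite (@le_anti _ _ a b) ?subee// ab ba.
Qed.

Lemma lebesgue_measure_itvcc_lty (R : realType) (a b : R) :
  (lebesgue_measure `[a, b]%classic < +oo)%E.
Proof.
by rewrite lebesgue_measure_itv/=; case: ifPn => // _; rewrite -EFinB ltry.
Qed.

Lemma normr_Rintegral_itvcc_le (R : realType) (g : R -> R) (a b K : R) :
  measurable_fun setT (g : measurableTypeR R -> R) ->
  (forall s, a <= s <= b -> `|g s| <= K) -> a <= b ->
  `|\int[lebesgue_measure]_(s in `[a, b]) g s| <= K * (b - a).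
Proof.
move=> mg gK ab; have := @normr_Rintegral_le _ _ _ lebesgue_measure `[a, b] g K.
rewrite [X in _ * fine X](lebesgue_measure_itvcc ab).
apply => //; first exact: lebesgue_measure_itvcc_lty.
  exact: measurable_funTS.
Qed.

Section oriented_integral.
Context {R : realType}.
Implicit Types (g : R -> R) (a b K : R).

Let mu := @lebesgue_measure R.

Let itv_integrable g a b K :
  measurable_fun setT (g : measurableTypeR R -> R) -> (forall s, `|g s| <= K) ->
  mu.-integrable `[a, b] (EFin \o g).
Proof.
move=> mg gK; apply: (@bounded_integrable _ _ _ _ _ _ K) => //.
  exact: lebesgue_measure_itvcc_lty.
  exact: measurable_funTS.
Qed.

Lemma Rintegral_itv_cat g a b c :
  mu.-integrable `[a, c] (EFin \o g) -> a <= b -> b <= c ->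
  \int[mu]_(s in `[a, c]) g s =
  \int[mu]_(s in `[a, b]) g s + \int[mu]_(s in `[b, c]) g s.
Proof.
move=> ig ab bc; apply/eqP; rewrite addrC -subr_eq; apply/eqP.
rewrite (@Rintegral_itvB _ g (BLeft a) (BRight c) b)//.
rewrite Rintegral_itv_obnd_cbnd//.
by apply: integrableS ig => //; apply: subset_itvr; rewrite bnd_simp.
Qed.

(** For a <= b the difference is the integral over [a, b] wherever 0 lies, which the sign cases
    verify. *)
Lemma oriented_integral_lipschitz g K a b :
  measurable_fun setT (g : measurableTypeR R -> R) -> (forall s, `|g s| <= K) ->
  `|oriented_integral g a - oriented_integral g b| <= K * `|a - b|.
Proof.
move=> mg gK.
wlog ab : a b / a <= b.
  move=> H; have [|/ltW] := leP a b; first exact: H.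
  by rewrite distrC (distrC a); exact: H.
rewrite distrC (distrC a) (ger0_norm (_ : 0 <= b - a)) ?subr_ge0//.
suff -> : oriented_integral g b - oriented_integral g a =
    \int[mu]_(s in `[a, b]) g s by exact: normr_Rintegral_itvcc_le.
rewrite /oriented_integral; case: (leP 0 a) => a0.
  rewrite (le_trans a0 ab) (Rintegral_itv_cat (itv_integrable _ _ mg gK) a0 ab).
  by rewrite addrC addKr.
case: leP => b0; rewrite opprK.
  by rewrite (Rintegral_itv_cat (itv_integrable _ _ mg gK) (ltW a0) b0) addrC.
rewrite (Rintegral_itv_cat (itv_integrable _ _ mg gK) ab (ltW b0)).
by rewrite addrC addrK.
Qed.

(** A Carathéodory function: Lipschitz in the endpoint and, for a fixed endpoint, a parametrized
    integral. *)
Lemma measurable_oriented_integral d (T : measurableType d)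
    (g : T * measurableTypeR R -> R) K :
  measurable_fun setT g -> (forall p, `|g p| <= K) ->
  measurable_fun setT (fun p : measurableTypeR R * T =>
    oriented_integral (fun s => g (p.2, s)) p.1).
Proof.
move=> mg gK; apply: measurable_fun_caratheodory => [c|t] /=.
- rewrite /oriented_integral; case: (0 <= c).
    by apply: measurable_fun_Rintegral => //; exact: sigma_finiteT.
  apply: measurable_funN.
  by apply: measurable_fun_Rintegral => //; exact: sigma_finiteT.
- apply: (@lipschitz_continuous _ _ K) => a b.
  apply: oriented_integral_lipschitz => //.
  exact: measurableT_comp.
Qed.

End oriented_integral.

Lemma measurable_normal (R : realType) d :
  measurable_fun setT (@normal R d).
Proof. by move=> _ B mB; exists B. Qed.

Section flux.
Context {R : realType} {d : nat} (F : R -> 'rV[R]_d.+1) (L : R).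
Hypothesis F_lipschitz : forall a b : R, enorm (F a - F b) <= L * `|a - b|.

(** The direction is kept as a variable because the flux is later integrated over the sphere. *)
Let edotF (p : sphere R d * measurableTypeR R) := edot (F p.2) (normal p.1).

Let edotF_lipschitz (n : sphere R d) a b :
  `|edotF (n, a) - edotF (n, b)| <= L * `|a - b|.
Proof.
rewrite -edotBl; apply: le_trans (cauchy_schwarz _ _) _.
by rewrite (eqP (Defs.normalP n)) mulr1.
Qed.

Let measurable_edotF : measurable_fun setT edotF.
Proof.
have mswap : measurable_fun setT (fun p : sphere R d * measurableTypeR R =>
   (p.2, p.1)) by exact: measurable_fun_pair.
apply: (@measurableT_comp _ _ _ _ _ _ (fun p => edotF (p.2, p.1)) _ _ _ mswap).
apply: measurable_fun_caratheodory => [c|n] /=.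
  apply: (@measurableT_comp _ _ _ _ _ _ (edot (F c)) _ (@normal R d) _
    (@measurable_normal R d)).
  apply: (@lipschitz_measurable_rV _ _ _ (enorm (F c))) => x y.
  by rewrite !(edotC (F c)) -edotBl mulrC; exact: cauchy_schwarz.
exact: lipschitz_continuous (edotF_lipschitz n).
Qed.

Let dF (p : sphere R d * measurableTypeR R) :=
  derive1 (fun s : R => edotF (p.1, s)) p.2.

Let measurable_dF : measurable_fun setT dF.
Proof.
apply: measurable_fun_derive1 => // n.
exact: lipschitz_continuous (edotF_lipschitz n).
Qed.

Let dF_le p : `|dF p| <= L.
Proof. by apply: normr_derive1_le => a b; exact: edotF_lipschitz. Qed.

Let L_ge0 : 0 <= L. Proof. exact: le_trans (dF_le point). Qed.

Let pos_le p : `|Num.max 0 (dF p)| <= L.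
Proof. by have := dF_le p; case: (ltP 0 (dF p)) => //; rewrite normr0. Qed.

Let neg_le p : `|Num.min 0 (dF p)| <= L.
Proof. by have := dF_le p; case: (ltP 0 (dF p)) => //; rewrite normr0. Qed.

Let mpos : measurable_fun setT (fun p => Num.max 0 (dF p)).
Proof. exact: measurable_maxr. Qed.

Let mneg : measurable_fun setT (fun p => Num.min 0 (dF p)).
Proof. exact: measurable_minr. Qed.

(** Taking the positive or the negative part of a derivative bounded by L does not enlarge it, so
    each part of the flux keeps the full constant L. *)
Lemma flux_plus_lipschitz (n : sphere R d) a b :
  `|flux_plus F n a - flux_plus F n b| <= L * `|a - b|.
Proof.
rewrite /flux_plus /increasing_part.
apply: oriented_integral_lipschitz => [|s]; last exact: (pos_le (n, s)).
exact: (measurableT_comp mpos (pair1_measurable n)).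
Qed.

Lemma flux_minus_lipschitz (n : sphere R d) a b :
  `|flux_minus F n a - flux_minus F n b| <= L * `|a - b|.
Proof.
rewrite /flux_minus /decreasing_part -opprD normrN.
apply: oriented_integral_lipschitz => [|s]; last exact: (neg_le (n, s)).
exact: (measurableT_comp mneg (pair1_measurable n)).
Qed.

Lemma measurable_flux_plus :
  measurable_fun setT (fun p : measurableTypeR R * sphere R d =>
    flux_plus F p.2 p.1).
Proof. exact: measurable_oriented_integral mpos pos_le. Qed.

Lemma measurable_flux_minus :
  measurable_fun setT (fun p : measurableTypeR R * sphere R d =>
    flux_minus F p.2 p.1).
Proof.
by apply: measurable_funN; exact: measurable_oriented_integral mneg neg_le.
Qed.

End flux.

(** * The upwind divergence as a Lipschitz operator *)

Section filter_mass.
Context {R : realType} (Phi : averaging_filter R).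

Lemma filter_at0_ge0 : 0 <= filter_at0 Phi.
Proof. exact: le_trans (filter_ge0 _ ltr01) (filter_le_at0 _ ltr01). Qed.

(** The Stieltjes mass of ]0, k] is Phi(0) - Phi(k^+), at most Phi(0) since Phi is non-negative; the
    half-line is the increasing union of these intervals. *)
Lemma opp_filter_deriv_mass :
  (opp_filter_deriv Phi `]0%R, +oo[%classic <= (filter_at0 Phi)%:E)%E.
Proof.
rewrite itv_bndy_bigcup_BRight.
pose I n : set (measurableTypeR R) := `]0 : R, 0 + n%:R]%classic.
have cI : (opp_filter_deriv Phi \o I) n @[n --> \oo] -->
    opp_filter_deriv Phi (\bigcup_n I n).
  apply: nondecreasing_cvg_mu; rewrite /I//; first exact: bigcup_measurable.
  move=> a b ab; apply/subsetPset/subset_itv; rewrite leBSide//= lerD2l.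
  by rewrite ler_nat.
apply: cvge_to_le cI _.
near=> k; rewrite /I /opp_filter_deriv /= /lebesgue_stieltjes_measure.
rewrite /measure_extension measurable_mu_extE/=; last exact: is_ocitv.
rewrite wlength_itv_bnd; last by rewrite lerDl.
rewrite lee_fin {2}/opp_filter maxxx opprK gerDr opp_filterE oppr_le0.
set x := Num.max _ _; have x0 : 0 <= x by rewrite le_max lexx orbT.
apply: (@le_trans _ _ (Phi (x + 1))).
  by apply: filter_ge0; rewrite ltr_wpDl.
apply: ub_le_sup; first exact: filter_has_ubound.
by exists (x + 1) => //=; rewrite in_itv/= andbT ltrDl.
Unshelve. all: by end_near. Qed.

Lemma sigma_finite_opp_filter_deriv :
  sigma_finite setT (opp_filter_deriv Phi).
Proof.
exact: (@sigma_finiteT _ _ _ (lebesgue_stieltjes_measure (opp_filter Phi))).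
Qed.

End filter_mass.

Lemma finite_sigma_finite d (T : measurableType d) (R : realType)
    (mu : {measure set T -> \bar R}) :
  (mu setT < +oo)%E -> sigma_finite setT mu.
Proof. by move=> muT; exists (fun=> setT) => //; rewrite bigcup_const. Qed.

Section upwind_operator.
Context {R : realType} {d : nat} (w : {measure set (sphere R d) -> \bar R}).
Context (Phi : averaging_filter R) (F : R -> 'rV[R]_d.+1) (L : R).
Hypothesis w_fin : (w setT < +oo)%E.
Hypothesis F_lipschitz : forall a b : R, enorm (F a - F b) <= L * `|a - b|.

Local Notation X := 'rV[R]_d.+1.
Local Notation m := (opp_filter_deriv Phi).
Local Notation D := (`]0 : R, +oo[%classic : set (measurableTypeR R)).
Implicit Types u v : X -> R.

Definition upwind_rate : R := 4 * L * fine (w setT) * filter_at0 Phi.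

Let L_ge0 : 0 <= L.
Proof.
have := F_lipschitz 1 0; rewrite subr0 normr1 mulr1; apply: le_trans.
exact: enorm_ge0.
Qed.

Let w_ge0 : 0 <= fine (w setT). Proof. exact: fine_ge0. Qed.

Lemma upwind_rate_ge0 : 0 <= upwind_rate.
Proof. by rewrite !mulr_ge0// filter_at0_ge0. Qed.

Let mD_fin : (m D < +oo)%E.
Proof. exact: le_lt_trans (opp_filter_deriv_mass Phi) (ltry _). Qed.

Let mD_le : fine (m D) <= filter_at0 Phi.
Proof.
rewrite -lee_fin fineK ?opp_filter_deriv_mass//.
by rewrite ge0_fin_numE.
Qed.

Let jump u (q : (X * sphere R d) * measurableTypeR R) : R :=
  flux_plus F q.1.2 (u q.1.1) -
  flux_plus F q.1.2 (u (q.1.1 + q.2 *: normal q.1.2)) +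
  flux_minus F q.1.2 (u q.1.1) -
  flux_minus F q.1.2 (u (q.1.1 - q.2 *: normal q.1.2)).

Let upwind_divE u x : upwind_div Phi w F u x =
  - \int[w]_n \int[m]_(r in D) jump u (x, n, r).
Proof. by []. Qed.

(** The factor [s] is 1 or - 1, which covers the translations in both directions. *)
Lemma measurable_translate d' (T : measurableType d') (s : R)
    (f : T -> X) (n : T -> sphere R d) (r : T -> measurableTypeR R) :
  measurable_fun setT f -> measurable_fun setT n -> measurable_fun setT r ->
  measurable_fun setT (fun t => f t + (s * r t) *: normal (n t)).
Proof.
move=> mf mn mr; apply: measurable_fun_rVP => i.
have c1 : measurable_fun setT (fun t => f t 0 i).
  exact: (measurableT_comp (measurable_coord i) mf).
have c2 : measurable_fun setT (fun t => normal (n t) 0 i).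
  apply: (measurableT_comp (measurable_coord i)).
  exact: (measurableT_comp (@measurable_normal R d) mn).
rewrite (_ : (fun t => _) = (fun t => f t 0 i + s * r t * normal (n t) 0 i)).
  apply: measurable_funD => //; apply: measurable_funM => //.
  exact: measurable_funM.
by apply/funext => t; rewrite !mxE.
Qed.

(** The parameter in [T] is time for the Picard iterates; [T] = [unit] recovers a single
    function. *)
Let measurable_jump d' (T : measurableType d') (u : T * X -> R) :
  measurable_fun setT u ->
  measurable_fun setT (fun q : ((T * X) * sphere R d) * measurableTypeR R =>
    jump (fun x => u (q.1.1.1, x)) (q.1.1.2, q.1.2, q.2)).
Proof.
move=> mu; rewrite /jump /=.
pose Q : measurableType _ := (((T * X) * sphere R d) * measurableTypeR R)%type.
have mn : measurable_fun setT
  (fun q : Q => q.1.2) by exact: measurableT_comp.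
have mt : measurable_fun setT
  (fun q : Q => q.1.1.1).
  by do 2! apply: measurableT_comp => //.
have mx : measurable_fun setT
  (fun q : Q => q.1.1.2).
  by do 2! apply: measurableT_comp => //.
have tr (s : R) : measurable_fun setT
  (fun q : Q =>
     u (q.1.1.1, q.1.1.2 + (s * q.2) *: normal q.1.2)).
  apply: measurableT_comp => //; apply: measurable_fun_pair => //.
  exact: measurable_translate.
have t0 : measurable_fun setT
  (fun q : Q =>
     u (q.1.1.1, q.1.1.2)).
  by apply: measurableT_comp => //; apply: measurable_fun_pair.
have fp (g : Q -> R)
  (mv : measurable_fun setT g) : measurable_fun setT
  (fun q : Q => flux_plus F q.1.2 (g q)).
  apply: (measurableT_comp (measurable_flux_plus F_lipschitz)
     (measurable_fun_pair mv mn)).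
have fm (g : Q -> R)
  (mv : measurable_fun setT g) : measurable_fun setT
  (fun q : Q => flux_minus F q.1.2 (g q)).
  apply: (measurableT_comp (measurable_flux_minus F_lipschitz)
     (measurable_fun_pair mv mn)).
apply: measurable_funB; first (apply: measurable_funD; first
  apply: measurable_funB).
- exact: fp.
- apply: fp; move: (tr 1); congr measurable_fun; apply/funext => q.
  by rewrite mul1r.
- exact: fm.
- apply: fm; move: (tr (- 1)); congr measurable_fun; apply/funext => q.
  by rewrite mulN1r scaleNr.
Qed.

Let measurable_inner d' (T : measurableType d') (u : T * X -> R) :
  measurable_fun setT u ->
  measurable_fun setT (fun q : (T * X) * sphere R d =>
    \int[m]_(r in D) jump (fun x => u (q.1.1, x)) (q.1.2, q.2, r)).
Proof.
move=> mu; apply: (measurable_fun_Rintegral _ _ (measurable_jump mu)) => //.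
exact: sigma_finite_opp_filter_deriv.
Qed.

Lemma measurable_upwind_div d' (T : measurableType d') (u : T * X -> R) :
  measurable_fun setT u ->
  measurable_fun setT (fun p : T * X =>
    upwind_div Phi w F (fun x => u (p.1, x)) p.2).
Proof.
move=> mu; apply: measurable_funN.
apply: (measurable_fun_Rintegral _ _ (measurable_inner mu)) => //.
exact: finite_sigma_finite.
Qed.



Let normr4_le (a b c e K : R) : `|a| <= K -> `|b| <= K -> `|c| <= K ->
  `|e| <= K -> `|a - b + c - e| <= 4 * K.
Proof.
rewrite !ler_norml => /andP[? ?] /andP[? ?] /andP[? ?] /andP[? ?].
by apply/andP; split; lra.
Qed.

(** The eight flux values are regrouped into four differences, each comparing u and v at the same
    displacement 0, r n or - r n from x and y. *)
Let jump_dist u v x y K q : (forall h, `|u (x + h) - v (y + h)| <= K) ->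
  `|jump u (x, q.1, q.2) - jump v (y, q.1, q.2)| <= 4 * (L * K).
Proof.
move=> uvK; rewrite /jump /=.
set a1 := flux_plus _ _ (u x); set a2 := flux_plus _ _ (u _).
set a3 := flux_minus _ _ (u x); set a4 := flux_minus _ _ (u _).
set b1 := flux_plus _ _ (v y); set b2 := flux_plus _ _ (v _).
set b3 := flux_minus _ _ (v y); set b4 := flux_minus _ _ (v _).
have -> : a1 - a2 + a3 - a4 - (b1 - b2 + b3 - b4) =
    (a1 - b1) - (a2 - b2) + (a3 - b3) - (a4 - b4) by ring.
have uv0 : `|u x - v y| <= K by have := uvK 0; rewrite !addr0.
apply: normr4_le.
- apply: le_trans (flux_plus_lipschitz F_lipschitz _ _ _) _.
  exact: ler_wpM2l.
- apply: le_trans (flux_plus_lipschitz F_lipschitz _ _ _) _.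
  exact: ler_wpM2l.
- apply: le_trans (flux_minus_lipschitz F_lipschitz _ _ _) _.
  exact: ler_wpM2l.
- apply: le_trans (flux_minus_lipschitz F_lipschitz _ _ _) _.
  exact: ler_wpM2l.
Qed.

Let jump_cst c q : jump (cst c) q = 0.
Proof. by rewrite /jump /= subrr add0r subrr. Qed.

(** Jumps of constants vanish, so growth is distance to the zero function. *)
Let jump_le u M x q : (forall z, `|u z| <= M) ->
  `|jump u (x, q.1, q.2)| <= 4 * (L * M).
Proof.
move=> uM; have := @jump_dist u (cst 0) x x M q.
by rewrite jump_cst subr0; apply => h; rewrite subr0.
Qed.

Let measurable_jump1 u x n : measurable_fun setT u ->
  measurable_fun setT (fun r : measurableTypeR R => jump u (x, n, r)).
Proof.
move=> mu; have mu' : measurable_fun setT (fun p : unit * X => u p.2).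
  exact: measurableT_comp.
exact: (measurableT_comp (measurable_jump mu') (pair1_measurable (tt, x, n))).
Qed.

Let measurable_inner1 u x : measurable_fun setT u ->
  measurable_fun setT (fun n => \int[m]_(r in D) jump u (x, n, r)).
Proof.
move=> mu; have mu' : measurable_fun setT (fun p : unit * X => u p.2).
  exact: measurableT_comp.
exact: (measurableT_comp (measurable_inner mu') (pair1_measurable (tt, x))).
Qed.

Let inner_le u M x n : measurable_fun setT u -> (forall z, `|u z| <= M) ->
  `|\int[m]_(r in D) jump u (x, n, r)| <= 4 * (L * M) * fine (m D).
Proof.
move=> mu uM; apply: normr_Rintegral_le => //.
  by apply: measurable_funTS; exact: measurable_jump1.
by move=> r _; exact: (@jump_le u M x (n, r)).
Qed.

(** With x = y this is the contraction estimate; with u = v it propagates moduli of continuity. [Mu]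
    and [Mv] serve integrability and do not enter the constant. *)
Lemma upwind_div_dist u v Mu Mv x y K :
  measurable_fun setT u -> measurable_fun setT v ->
  (forall z, `|u z| <= Mu) -> (forall z, `|v z| <= Mv) ->
  (forall h, `|u (x + h) - v (y + h)| <= K) ->
  `|upwind_div Phi w F u x - upwind_div Phi w F v y| <= upwind_rate * K.
Proof.
move=> mu mv uM vM uvK; rewrite !upwind_divE -opprD normrN.
have K0 : 0 <= K by apply: le_trans (uvK 0).
have -> : upwind_rate * K = 4 * (L * K) * filter_at0 Phi * fine (w setT).
  by rewrite /upwind_rate; ring.
apply: normr_RintegralB_le => //.
- exact: measurable_inner1.
- exact: measurable_inner1.
- by move=> n _; exact: inner_le uM.
- by move=> n _; exact: inner_le vM.
move=> n _.
apply: (@le_trans _ _ (4 * (L * K) * fine (m D))); last first.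
  by apply: ler_wpM2l mD_le; rewrite mulr_ge0// mulr_ge0.
apply: normr_RintegralB_le => //.
- by apply: measurable_funTS; exact: measurable_jump1.
- by apply: measurable_funTS; exact: measurable_jump1.
- by move=> r _; exact: (@jump_le u Mu x (n, r)).
- by move=> r _; exact: (@jump_le v Mv y (n, r)).
- by move=> r _; exact: (@jump_dist u v x y K (n, r)).
Qed.

Lemma upwind_div_le u M x : measurable_fun setT u -> (forall z, `|u z| <= M) ->
  `|upwind_div Phi w F u x| <= upwind_rate * M.
Proof.
move=> mu uM.
have <- : `|upwind_div Phi w F u x - upwind_div Phi w F (cst 0) x| =
    `|upwind_div Phi w F u x|.
  rewrite [X in _ - X]upwind_divE.
  under eq_Rintegral => n _.
    under eq_Rintegral => r _ do rewrite jump_cst.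
    rewrite Rintegral_cst// mul0r; over.
  by rewrite Rintegral_cst// mul0r oppr0 subr0.
apply: (@upwind_div_dist _ _ M 0) => //.
- by move=> z; rewrite normr0.
- by move=> h; rewrite subr0.
Qed.

Local Notation leb := (lebesgue_rV d.+1).

(** For fixed (n, r) the x whose translate falls into N = {u <> v} form a translate of a null set.
    Exchanging the order of integration over (x, n, r), almost every x has only negligibly many bad
    (n, r). *)
Let ae_translate u v (s : R) :
  measurable_fun setT u -> measurable_fun setT v -> ae_equal u v ->
  {ae leb, forall x, {ae w, forall n, {ae m, forall r,
    u (x + (s * r) *: normal n) = v (x + (s * r) *: normal n)}}}.
Proof.
move=> mu mv uv.
pose w' : {sigma_finite_measure set _ -> \bar R} :=
  sigma_finite_copy (finite_sigma_finite w_fin).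
pose m' : {sigma_finite_measure set _ -> \bar R} :=
  sigma_finite_copy (sigma_finite_opp_filter_deriv Phi).
pose t (p : X * (sphere R d * measurableTypeR R)) : X :=
  p.1 + (s * p.2.2) *: normal p.2.1.
have mt : measurable_fun setT t.
  by apply: measurable_translate => //; exact: measurableT_comp.
pose N : set X := [set x | u x - v x != 0].
have mN : measurable N.
  rewrite (_ : N = (u \- v) @^-1` (~` [set 0])).
    rewrite -[X in measurable X]setTI; apply: measurable_funB => //.
    exact: measurableC.
  by apply/seteqP; split => x /= /eqP.
have N0 : leb N = 0%E.
  apply: measure_negligible => //; apply: negligibleS uv => x /=.
  by rewrite /N /= subr_eq0 => /eqP nuv H; apply: nuv; exact: H.
have mE : measurable (t @^-1` N).
  by rewrite -[X in measurable X]setTI; exact: mt.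
have : forall q, leb (ysection (t @^-1` N) q) = 0%E.
  move=> q; rewrite (_ : ysection _ _ =
      (fun x => x + (s * q.2) *: normal q.1) @^-1` N).
    exact: lebesgue_rV_translation_null.
  by apply/seteqP; split => x; rewrite /ysection /= inE.
move=> /(ae_xsection2_null w' m' mE); apply: filterS => x.
apply: filterS => n nE.
exists (xsection (xsection (t @^-1` N) x) n); split => //.
  by do 2! apply: measurable_xsection.
move=> r /= /eqP ur; rewrite /xsection /= !inE /= inE /=.
by rewrite /N /t /= subr_eq0.
Qed.

Lemma ae_equal_upwind_div u v :
  measurable_fun setT u -> measurable_fun setT v -> ae_equal u v ->
  ae_equal (upwind_div Phi w F u) (upwind_div Phi w F v).
Proof.
move=> mu mv uv.
apply: filterS3 uv (ae_translate 1 mu mv uv) (ae_translate (- 1) mu mv uv).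
move=> x /(_ I) uvx px mx _.
rewrite (upwind_divE u x) (upwind_divE v x).
apply: f_equal.
apply: ae_eq_Rintegral => //.
- exact: measurable_inner1.
- exact: measurable_inner1.
apply: filterS2 px mx => n pn mn _.
apply: ae_eq_Rintegral => //.
- by apply: measurable_funTS; exact: measurable_jump1.
- by apply: measurable_funTS; exact: measurable_jump1.
have aeF : Filter (almost_everywhere m).
  exact: ae_filter_ringOfSetsType.
apply: filterS2 pn mn => r pr mr _; rewrite /jump /= uvx.
by move: pr mr; rewrite mul1r mulN1r scaleNr => -> ->.
Qed.

End upwind_operator.

(** * Picard iteration *)

Lemma geometric_cvg (R : realType) (a : R^nat) (B : R) :
  (forall k, `|a k.+1 - a k| <= B * 2^-1 ^+ k) ->
  a k @[k --> \oo] --> limn a /\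
  forall k, `|limn a - a k| <= 2 * B * 2^-1 ^+ k.
Proof.
move=> aB.
have p0 k : 0 <= 2^-1 ^+ k :> R by rewrite exprn_ge0.
(* The sequences [a k -+ 2 B 2^-k] are monotone and enclose the limit. *)
have B0 : 0 <= B by have := le_trans (normr_ge0 _) (aB 0); rewrite expr0 mulr1.
pose b k := a k - 2 * B * 2^-1 ^+ k; pose c k := a k + 2 * B * 2^-1 ^+ k.
have bS k : b k <= b k.+1.
  by have := aB k; rewrite ler_norml /b exprS => /andP[h _]; lra.
have cS k : c k.+1 <= c k.
  by have := aB k; rewrite ler_norml /c exprS => /andP[_ h]; lra.
have bc k : b k <= c k.
  by have := mulr_ge0 B0 (p0 k); rewrite /b /c; lra.
have nb : nondecreasing_seq b by apply/nondecreasing_seqP.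
have nc : nonincreasing_seq c by apply/nonincreasing_seqP.
have bck k l : b k <= c l.
  apply: le_trans (nb _ _ (leq_maxl k l)) _.
  by apply: le_trans (bc _) _; apply: nc; exact: leq_maxr.
have cvb : cvgn b.
  apply: nondecreasing_is_cvgn => //; exists (c 0) => _ [k _ <-]; exact: bck.
have cvp : 2 * B * 2^-1 ^+ k @[k --> \oo] --> (2 * B * 0 : R).
  by apply: cvgMr; apply: cvg_expr; rewrite ger0_norm; lra.
have cva : a k @[k --> \oo] --> limn b.
  rewrite -[limn b]addr0 -[X in _ + X](mulr0 (2 * B)).
  rewrite (_ : a = fun k => b k + 2 * B * 2^-1 ^+ k); last first.
    by apply/funext => k; rewrite /b subrK.
  exact: cvgD cvb cvp.
have -> : limn a = limn b by exact/cvg_lim.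
split => // k; rewrite ler_norml; apply/andP; split.
  have : b k <= limn b by apply: nondecreasing_cvgn_le.
  rewrite {1}/b; lra.
have : limn b <= c k by apply: limr_le => //; exact: nearW.
rewrite /c; lra.
Qed.

(** Keeping the factor [l] in the integrand, rather than dividing by it, includes l = 0, which
    occurs when C = 0. *)
Lemma Rintegral_expR (R : realType) (K l t : R) : 0 <= t ->
  \int[lebesgue_measure]_(s in `[0, t]) (K * l * expR (l * s)) =
  K * (expR (l * t) - 1).
Proof.
rewrite le_eqVlt => /predU1P[<-|t0].
  by rewrite set_itv1 Rintegral_set1 mulr0 expR0 subrr mulr0.
pose f s : R := K * l * expR (l * s).
pose G s : R := K * expR (l * s).
have dG s : is_derive s (1 : R) G (f s).
  rewrite /G; apply: is_derive_eq.
  by rewrite /f /GRing.scale /=; ring.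
have cG : continuous G.
  move=> s; apply: differentiable_continuous; apply/derivable1_diffP.
  exact: ex_derive.
have cf : continuous f.
  rewrite (_ : f = fun s => l * G s); last first.
    by apply/funext => s; rewrite /f /G; ring.
  by move=> s; apply: cvgM; [exact: cvg_cst|exact: cG].
rewrite /Rintegral (@continuous_FTC2 _ f G) //.
- by rewrite /G mulr0 expR0 /= mulr1 mulrBr mulr1.
- exact: continuous_subspaceT.
- split.
  + by move=> s _; apply: ex_derive.
  + by apply: cvg_at_right_filter; exact: cG.
  + by apply: cvg_at_left_filter; exact: cG.
- by move=> s _; rewrite derive1E; apply: derive_val.
Qed.

Section picard.
Context {R : realType} {n : nat}.
Local Notation X := 'rV[R]_n.
Local Notation leb1 := (@lebesgue_measure R).
Implicit Types (u v g : X -> R) (U V : R -> X -> R) (s t M K : R).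

Definition jointly_measurable U :=
  measurable_fun setT (fun p : measurableTypeR R * X => U p.1 p.2).

Lemma jointly_measurable_at U t :
  jointly_measurable U -> measurable_fun setT (U t).
Proof. by move=> mU; exact: (measurableT_comp mU (pair1_measurable t)). Qed.

Context (A : (X -> R) -> X -> R) (C : R).
Hypothesis C_ge0 : 0 <= C.
Hypothesis A_measurable : forall U, jointly_measurable U ->
  jointly_measurable (fun t => A (U t)).
Hypothesis A_dist : forall u v Mu Mv x y K,
  measurable_fun setT u -> measurable_fun setT v ->
  (forall z, `|u z| <= Mu) -> (forall z, `|v z| <= Mv) ->
  (forall h, `|u (x + h) - v (y + h)| <= K) -> `|A u x - A v y| <= C * K.
Hypothesis A_le : forall u M x, measurable_fun setT u ->
  (forall z, `|u z| <= M) -> `|A u x| <= C * M.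

Let A_time U x : jointly_measurable U ->
  measurable_fun setT (fun s : measurableTypeR R => A (U s) x).
Proof.
by move=> mU; exact: (measurableT_comp (A_measurable mU) (pair2_measurable x)).
Qed.

Definition picard g U t x : R := g x + \int[leb1]_(s in `[0, t]) A (U s) x.

Let picard_measurable g U : measurable_fun setT g -> jointly_measurable U ->
  jointly_measurable (picard g U).
Proof.
move=> mg mU; rewrite /jointly_measurable /picard.
apply: measurable_funD; first exact: measurableT_comp.
(* The moving domain [0, t] becomes an indicator in (t, x, s), so that the parametrized integral
   runs over a fixed domain. *)
pose f (q : (measurableTypeR R * X) * measurableTypeR R) :=
  A (U q.2) q.1.2 * \1_[set q : (measurableTypeR R * X) * measurableTypeR R |
     0 <= q.2 <= q.1.1] q.
rewrite (_ : (fun p => _) = fun p => \int[leb1]_(s in setT) f (p, s)).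
  apply: measurable_fun_Rintegral => //; first exact: sigma_finiteT.
  rewrite /f; apply: measurable_funM.
    apply: (measurableT_comp (A_measurable mU)
      (g := fun q : (measurableTypeR R * X) * measurableTypeR R =>
        (q.2, q.1.2))).
    by apply: measurable_fun_pair => //; exact: measurableT_comp.
  apply: measurable_indic.
  rewrite (_ : [set q | _] = [set q | 0 <= q.2] `&` [set q | q.2 <= q.1.1]).
    apply: measurableI.
      rewrite -[X in measurable X]setTI; apply: measurable_fun_le => //.
    rewrite -[X in measurable X]setTI; apply: measurable_fun_le => //.
    exact: measurableT_comp.
  by apply/seteqP; split => q /=; [move=> /andP[]|move=> [-> ->]].
apply/funext => -[t x] /=; rewrite Rintegral_mkcond; apply: eq_Rintegral => s _.
rewrite patchE /f indicE /=; case: ifPn.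
  by rewrite inE /= in_itv/= => h; rewrite mem_set// mulr1.
by rewrite notin_setE /= in_itv/= => h; rewrite memNset// mulr0.
Qed.

(** Exponential bounds reproduce themselves under time integration: adding the initial K to K (exp(l
    t) - 1) gives back K exp(l t). This closes the inductions on the iterates. *)
Let itv_expR_le f l K t : measurable_fun setT (f : measurableTypeR R -> R) ->
  0 <= t -> (forall s, 0 <= s <= t -> `|f s| <= K * l * expR (l * s)) ->
  `|\int[leb1]_(s in `[0, t]) f s| <= K * (expR (l * t) - 1).
Proof.
move=> mf t0 fK.
have me : measurable_fun setT
    (fun s : measurableTypeR R => K * l * expR (l * s)).
  apply: measurable_funM => //; apply: measurableT_comp => //.
have fi : leb1.-integrable `[0, t] (EFin \o (fun s => K * l * expR (l * s))).
  apply: (@bounded_integrable _ _ _ _ _ _ (`|K * l| * expR (`|l| * t))) => //.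
    exact: lebesgue_measure_itvcc_lty.
    exact: measurable_funTS.
  move=> s; rewrite /= in_itv/= => /andP[s0 st].
  rewrite normrM (ger0_norm (expR_ge0 _)) ler_wpM2l// ler_expR.
  apply: le_trans (ler_wpM2l (normr_ge0 l) st).
  by rewrite ler_wpM2r// ler_norm.
have ff : leb1.-integrable `[0, t] (EFin \o f).
  apply: le_integrable fi => //.
    by apply/measurable_EFinP; exact: measurable_funTS.
  move=> s; rewrite /= in_itv/= => /fK h; rewrite lee_fin.
  exact: le_trans h (ler_norm _).
rewrite -Rintegral_expR//; apply: le_trans (le_normr_Rintegral _ ff) _ => //.
apply: le_Rintegral => //.
  exact: integrable_norm ff.
Qed.

Section iteration.
Context (g : X -> R) (M : R).
Hypothesis g_measurable : measurable_fun setT g.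
Hypothesis gM : forall x, `|g x| <= M.

Let M_ge0 : 0 <= M. Proof. exact: le_trans (gM 0). Qed.

Let u_ k : R -> X -> R := iter k (picard g) (fun=> g).

Let u_meas k : jointly_measurable (u_ k).
Proof.
elim: k => [|k IH]; last exact: picard_measurable.
exact: measurableT_comp.
Qed.

Let uk_meas k s : measurable_fun setT (u_ k s).
Proof. exact: jointly_measurable_at. Qed.

Let uS k t x : u_ k.+1 t x = g x + \int[leb1]_(s in `[0, t]) A (u_ k s) x.
Proof. by []. Qed.

Let u_bound k t x : 0 <= t -> `|u_ k t x| <= M * expR (C * t).
Proof.
elim: k t x => [|k IH] t x t0.
  apply: le_trans (gM x) _; rewrite ler_peMr//.
  by rewrite -expR0 ler_expR mulr_ge0.
rewrite uS (_ : M * _ = M + M * (expR (C * t) - 1)); last by ring.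
apply: le_trans (ler_normD _ _) _; apply: lerD => //.
apply: itv_expR_le => //; first exact: A_time.
move=> s /andP[s0 st]; rewrite (mulrC M) -mulrA.
by apply: A_le => // z; exact: IH.
Qed.

(** The hypothesis ranges over all h because A is nonlocal: the induction hypothesis is used at x +
    h and y + h. The rate is C, not the contraction weight, so the limit has the sharp exponent. *)
Let u_shift k x y K t : 0 <= t -> (forall h, `|g (x + h) - g (y + h)| <= K) ->
  `|u_ k t x - u_ k t y| <= K * expR (C * t).
Proof.
elim: k x y t => [|k IH] x y t t0 gK.
  have := gK 0; rewrite !addr0 => h; apply: le_trans h _; rewrite ler_peMr//.
    exact: le_trans (gK 0).
  by rewrite -expR0 ler_expR mulr_ge0.
rewrite !uS (_ : K * _ = K + K * (expR (C * t) - 1)); last by ring.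
rewrite opprD addrACA; apply: le_trans (ler_normD _ _) _; apply: lerD.
  by have := gK 0; rewrite !addr0.
have fi z : leb1.-integrable `[0, t] (EFin \o (fun s => A (u_ k s) z)).
  apply: (@bounded_integrable _ _ _ _ _ _ (C * (M * expR (C * t)))) => //.
  - exact: lebesgue_measure_itvcc_lty.
  - by apply: measurable_funTS; exact: A_time.
  move=> s; rewrite /= in_itv/= => /andP[s0 st].
  apply: A_le => // z'; apply: le_trans (u_bound k _ s0) _.
  by rewrite ler_wpM2l// ler_expR ler_wpM2l.
rewrite -RintegralB//; apply: itv_expR_le => //.
  by apply: measurable_funB; exact: A_time.
move=> s /andP[s0 st]; rewrite (mulrC K) -mulrA.
apply: (A_dist (Mu := M * expR (C * s)) (Mv := M * expR (C * s))) => //.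
- by move=> z; exact: u_bound.
- by move=> z; exact: u_bound.
move=> h; apply: IH => // h'; rewrite -!addrA; exact: gK.
Qed.

(* With respect to the weight exp (- l t), the Picard map contracts by 1 / 2;
   the summand 1 is there for [C = 0]. *)
Let l := 2 * (C + 1).

Let l_ge0 : 0 <= l. Proof. by rewrite mulr_ge0// addr_ge0. Qed.

Let A_int U t x B : jointly_measurable U -> 0 <= t ->
  (forall s z, 0 <= s -> `|U s z| <= B * expR (C * s)) ->
  leb1.-integrable `[0, t] (EFin \o (fun s => A (U s) x)).
Proof.
move=> mU t0 UM.
have B0 : 0 <= B.
  have := le_trans (normr_ge0 _) (UM 0 0 (lexx 0)).
  by rewrite mulr0 expR0 mulr1.
apply: (@bounded_integrable _ _ _ _ _ _ (C * (B * expR (C * t)))) => //.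
- exact: lebesgue_measure_itvcc_lty.
- by apply: measurable_funTS; exact: A_time.
move=> s; rewrite /= in_itv/= => /andP[s0 st].
apply: A_le; first exact: jointly_measurable_at.
move=> z; apply: le_trans (UM s z s0) _.
by rewrite ler_wpM2l// ler_expR ler_wpM2l.
Qed.

Let picard_contract U V t x B : 0 <= t -> 0 <= B ->
  jointly_measurable U -> jointly_measurable V ->
  (forall s z, 0 <= s -> `|U s z| <= M * expR (C * s)) ->
  (forall s z, 0 <= s -> `|V s z| <= M * expR (C * s)) ->
  (forall s z, 0 <= s -> `|U s z - V s z| <= B * expR (l * s)) ->
  `|picard g U t x - picard g V t x| <= B / 2 * expR (l * t).
Proof.
move=> t0 B0 mU mV UM VM UV; rewrite /picard opprD addrACA subrr add0r.
rewrite -RintegralB//; [|exact: A_int UM|exact: A_int VM].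
apply: (@le_trans _ _ (B / 2 * (expR (l * t) - 1))); last first.
  by rewrite ler_wpM2l ?divr_ge0// gerBl.
apply: itv_expR_le => //; first by apply: measurable_funB; exact: A_time.
move=> s /andP[s0 st].
apply: (@le_trans _ _ (C * (B * expR (l * s)))).
  apply: (A_dist (Mu := M * expR (C * s)) (Mv := M * expR (C * s))) => //.
  - exact: jointly_measurable_at.
  - exact: jointly_measurable_at.
  - by move=> z; exact: UM.
  - by move=> z; exact: VM.
  - by move=> h; exact: UV.
rewrite mulrA ler_wpM2r ?expR_ge0//.
rewrite (_ : B / 2 * l = C * B + B); last by rewrite /l; field.
by rewrite lerDl.
Qed.

Let u_step k t x : 0 <= t ->
  `|u_ k.+1 t x - u_ k t x| <= M * 2^-1 ^+ k * expR (l * t).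
Proof.
elim: k t x => [|k IH] t x t0.
  rewrite uS expr0 mulr1 addrC addKr.
  apply: (@le_trans _ _ (M * (expR (l * t) - 1))); last first.
    by rewrite ler_wpM2l// gerBl.
  apply: itv_expR_le => //; first exact: A_time.
  move=> s /andP[s0 st]; apply: (@le_trans _ _ (C * M)); first exact: A_le.
  rewrite (mulrC C) -mulrA ler_wpM2l//.
  have e1 : 1 <= expR (l * s) by rewrite -expR0 ler_expR mulr_ge0.
  apply: le_trans (ler_peMr l_ge0 e1).
  by have := C_ge0; rewrite /l; lra.
have := @picard_contract (u_ k.+1) (u_ k) t x (M * 2^-1 ^+ k) t0.
rewrite exprSr [M * (_ * _)]mulrA; apply => //.
- by rewrite mulr_ge0// exprn_ge0.
- by move=> s z; exact: u_bound.
- by move=> s z; exact: u_bound.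
Qed.

(** For negative t the interval [0, t] is empty. The iterates thus converge at all real times, as
    measurability of the limit on the whole product requires. *)
Let u_neg k t x : t < 0 -> u_ k t x = g x.
Proof.
case: k => [//|k] t0; rewrite uS set_itv_ge ?bnd_simp -?ltNge//.
by rewrite Rintegral_set0 addr0.
Qed.

Let u t x := limn (fun k => u_ k t x).

Let u_cvg t x : u_ k t x @[k --> \oo] --> u t x /\
  (0 <= t -> forall k, `|u t x - u_ k t x| <= 2 * M * 2^-1 ^+ k * expR (l * t)).
Proof.
have [t0|t0] := leP 0 t.
  have [] := @geometric_cvg R (fun k => u_ k t x) (M * expR (l * t)).
    by move=> k; rewrite mulrAC; exact: u_step.
  move=> h1 h2; split => // _ k.
  by rewrite (_ : 2 * M * _ * _ = 2 * (M * expR (l * t)) * 2^-1 ^+ k) //; ring.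
split => //; rewrite /u (_ : (fun k => _) = cst (g x)).
  by rewrite lim_cst//; exact: cvg_cst.
by apply/funext => k; rewrite u_neg.
Qed.

Let u_measurable : jointly_measurable u.
Proof.
apply: (@measurable_fun_cvg _ _ _ _ (fun k p => u_ k p.1 p.2)).
  by move=> k; exact: u_meas.
by move=> [t x] _; have [] := u_cvg t x.
Qed.

Let lim_norm_le (a : R^nat) (b c B : R) :
  a k @[k --> \oo] --> b -> (forall k, `|a k - c| <= B) -> `|b - c| <= B.
Proof.
move=> ab aB; have nab : `|a k - c| @[k --> \oo] --> `|b - c|.
  by apply: cvg_norm; apply: cvgB => //; exact: cvg_cst.
exact: (cvgr_to_le nab (nearW _ aB)).
Qed.

Let u_le t x : 0 <= t -> `|u t x| <= M * expR (C * t).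
Proof.
move=> t0; rewrite -[u t x]subr0; apply: lim_norm_le (u_cvg t x).1 _ => k.
by rewrite subr0; exact: u_bound.
Qed.

(** Both sides lie within M exp(l t) 2^-k of the iterate of index k + 1, the right one by
    contraction. *)
Let u_eq t x : 0 <= t -> u t x = picard g u t x.
Proof.
move=> t0; apply/eqP; rewrite -subr_eq0 -normr_le0.
pose D := M * expR (l * t).
have bnd k : `|u t x - picard g u t x| <= 2 * D * 2^-1 ^+ k.
  have h1 := (u_cvg t x).2 t0 k.+1.
  have := @picard_contract u (u_ k) t x (2 * M * 2^-1 ^+ k) t0.
  have p0 : 0 <= 2 * M * 2^-1 ^+ k by rewrite !mulr_ge0// exprn_ge0.
  move=> /(_ p0 u_measurable (u_meas k)) h2.
  have {}h2 : `|picard g u t x - u_ k.+1 t x| <=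
     2 * M * 2^-1 ^+ k / 2 * expR (l * t).
    apply: h2 => s z s0; [exact: u_le|exact: u_bound|exact: (u_cvg s z).2].
  apply: le_trans (ler_distD (u_ k.+1 t x) _ _) _; rewrite (distrC (u_ _ _ _)).
  apply: le_trans (lerD h1 h2) _.
  rewrite exprS /D le_eqVlt; apply/orP; left; apply/eqP; by field.
have c0 : 2 * D * 2^-1 ^+ k @[k --> \oo] --> (2 * D * 0 : R).
  by apply: cvgMr; apply: cvg_expr; rewrite ger0_norm; lra.
rewrite mulr0 in c0; exact: (cvgr_to_ge c0 (nearW _ bnd)).
Qed.

Lemma picard_solution : exists U : R -> X -> R,
  [/\ jointly_measurable U,
      forall t x, 0 <= t -> `|U t x| <= M * expR (C * t),
      forall t x, 0 <= t -> U t x = picard g U t x &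
      forall x y K t, 0 <= t -> (forall h, `|g (x + h) - g (y + h)| <= K) ->
        `|U t x - U t y| <= K * expR (C * t)].
Proof.
exists u; split => // x y K t t0 gK.
have uxy : u_ k t x - u_ k t y @[k --> \oo] --> u t x - u t y.
  by apply: cvgB; exact: (u_cvg _ _).1.
rewrite -[u t x - _]subr0; apply: lim_norm_le uxy _ => k.
by rewrite subr0; exact: u_shift.
Qed.

(** On [0, T] the velocity A(U) is bounded, so U is Lipschitz in time uniformly in x; hence A(U) is
    too, and the first-order remainder is quadratic. *)
Lemma picard_increment U T s t x : jointly_measurable U ->
  (forall t x, 0 <= t -> `|U t x| <= M * expR (C * t)) ->
  (forall t x, 0 <= t -> U t x = picard g U t x) ->
  0 <= s <= T -> 0 <= t <= T ->
  `|U t x - U s x| <= C * (M * expR (C * T)) * `|t - s| /\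
  `|U t x - U s x - (t - s) * A (U s) x| <=
    C * (C * (M * expR (C * T))) * `|t - s| ^+ 2.
Proof.
move=> mU UM Ueq; set B := C * (M * expR (C * T)).
have UT r z : 0 <= r <= T -> `|U r z| <= M * expR (C * T).
  move=> /andP[r0 rT]; apply: le_trans (UM _ _ r0) _.
  by rewrite ler_wpM2l// ler_expR ler_wpM2l.
have AUT r z : 0 <= r <= T -> `|A (U r) z| <= B.
  by move=> rT; apply: A_le => [|z']; [exact: jointly_measurable_at|exact: UT].
have B0 : 0 <= B by rewrite !mulr_ge0.
have int a b z : 0 <= a -> b <= T ->
    leb1.-integrable `[a, b] (EFin \o (fun r => A (U r) z)).
  move=> a0 bT; apply: (@bounded_integrable _ _ _ _ _ _ B) => //.
    exact: lebesgue_measure_itvcc_lty.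
    by apply: measurable_funTS; exact: A_time.
  move=> r; rewrite /= in_itv/= => /andP[ar rb]; apply: AUT.
  by rewrite (le_trans a0 ar) (le_trans rb bT).
have inc a b z : 0 <= a -> a <= b -> b <= T ->
    U b z - U a z = \int[leb1]_(r in `[a, b]) A (U r) z.
  move=> a0 ab bT; have b0 := le_trans a0 ab.
  rewrite (Ueq b z b0) (Ueq a z a0) /picard.
  rewrite (Rintegral_itv_cat (int 0 b z (lexx 0) bT) a0 ab).
  by rewrite opprD addrACA subrr add0r addrC addKr.
have inc1 a b z : 0 <= a -> a <= b -> b <= T -> `|U b z - U a z| <= B * (b - a).
  move=> a0 ab bT; rewrite inc//; apply: normr_Rintegral_itvcc_le => //.
    exact: A_time.
  move=> r /andP[ar rb]; apply: AUT.
  by rewrite (le_trans a0 ar) (le_trans rb bT).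
have inc1' a b z : 0 <= a <= T -> 0 <= b <= T ->
    `|U b z - U a z| <= B * `|b - a|.
  move=> /andP[a0 aT] /andP[b0 bT]; have [ab|/ltW ba] := leP a b.
    by rewrite (ger0_norm (_ : 0 <= b - a)) ?subr_ge0//; exact: inc1.
  rewrite distrC (distrC b) (ger0_norm (_ : 0 <= a - b)) ?subr_ge0//.
  exact: inc1.
(* The velocity is frozen at any c in [a, b]: c = a serves forward increments, c = b backward
   ones. *)
have inc2 a b c z : 0 <= a -> a <= b -> b <= T -> a <= c <= b ->
    `|U b z - U a z - (b - a) * A (U c) z| <= C * B * (b - a) ^+ 2.
  move=> a0 ab bT /andP[ac cb].
  have c0T : 0 <= c <= T by rewrite (le_trans a0 ac) (le_trans cb bT).
  have -> : (b - a) * A (U c) z = \int[leb1]_(r in `[a, b]) A (U c) z.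
    rewrite Rintegral_cst// mulrC; congr (_ * _).
    by rewrite [X in fine X](lebesgue_measure_itvcc ab).
  rewrite inc// -RintegralB//; [|exact: int|]; last first.
    apply: (@bounded_integrable _ _ _ _ _ _ `|A (U c) z|) => //.
    exact: lebesgue_measure_itvcc_lty.
  rewrite expr2 mulrA; apply: normr_Rintegral_itvcc_le => //.
    by apply: measurable_funB => //; exact: A_time.
  move=> r /andP[ar rb]; have r0T : 0 <= r <= T.
    by rewrite (le_trans a0 ar) (le_trans rb bT).
  rewrite -mulrA.
  apply: (A_dist (Mu := M * expR (C * T)) (Mv := M * expR (C * T))).
  - exact: jointly_measurable_at.
  - exact: jointly_measurable_at.
  - by move=> z'; exact: UT.
  - by move=> z'; exact: UT.
  move=> h; apply: le_trans (inc1' _ _ _ c0T r0T) _; rewrite ler_wpM2l//.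
  by rewrite ler_norml; apply/andP; split; lra.
move=> sT tT; split; first exact: inc1'.
move: sT tT => /andP[s0 sT] /andP[t0 tT]; have [st|/ltW ts] := leP s t.
  rewrite (ger0_norm (_ : 0 <= t - s)) ?subr_ge0//.
  by apply: inc2; rewrite ?lexx.
rewrite (distrC t s) (ger0_norm (_ : 0 <= s - t)) ?subr_ge0//.
have -> : U t x - U s x - (t - s) * A (U s) x =
    - (U s x - U t x - (s - t) * A (U s) x) by ring.
rewrite normrN.
by apply: inc2; rewrite ?lexx ?andbT.
Qed.

End iteration.
End picard.

(** * Gronwall estimate and uniqueness *)

(** phi need not be differentiable: a local slope of at most C phi + e cannot cross the barrier eta
    exp((C + 1) t), whose excess rate 1 absorbs e. Then eta tends to 0. *)
Lemma dini_gronwall (R : realType) (phi : R -> R) (C : R) :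
  0 <= C -> (forall t, 0 <= t -> 0 <= phi t) -> phi 0 = 0 ->
  (forall t e, 0 <= t -> 0 < e -> exists2 d, 0 < d &
    forall s, 0 <= s -> `|s - t| < d ->
      `|phi s - phi t| <= `|s - t| * (C * phi t + e)) ->
  forall t, 0 <= t -> phi t = 0.
Proof.
move=> C0 phi0 phi00 H.
suff bnd eta T : 0 < eta -> 0 <= T -> phi T <= eta * expR ((C + 1) * T).
  move=> t t0; apply/eqP; rewrite eq_le phi0// andbT.
  apply/ler_addgt0Pr => e e0; rewrite add0r.
  have := bnd (e * expR (- ((C + 1) * t))) t.
  by rewrite -mulrA -expRD addNr expR0 mulr1 mulr_gt0// ?expR_gt0//; apply.
move=> eta0 T0; rewrite leNgt; apply/negP => phiT.
(* t is the first time at which phi exceeds eta exp ((C + 1) t). *)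
pose S := [set s | 0 <= s /\ eta * expR ((C + 1) * s) < phi s].
have S0 : S !=set0 by exists T.
have Slb : has_lbound S by exists 0 => s [].
pose t := inf S.
have t0 : 0 <= t by apply: lb_le_inf => // s [].
have tS s : 0 <= s -> s < t -> phi s <= eta * expR ((C + 1) * s).
  move=> s0 st; rewrite leNgt; apply/negP => h.
  have : t <= s by apply: ge_inf.
  lra.
have phit : phi t <= eta * expR ((C + 1) * t).
  rewrite leNgt; apply/negP => gap.
  have t_gt0 : 0 < t.
    rewrite lt_def t0 andbT; apply/eqP => t00.
    move: gap; rewrite t00 phi00 mulr0 expR0 mulr1; lra.
  have [d d0 dH] := H t 1 t0 ltr01.
  pose D := C * phi t + 1.
  have D0 : 0 < D by rewrite ltr_wpDl// mulr_ge0// phi0.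
  (* A step back by h stays within the radius d and in [0, t[, and lowers phi by at most half the
     gap, so phi would exceed the barrier before t. *)
  pose h := Num.min (Num.min (d / 2) t)
    ((phi t - eta * expR ((C + 1) * t)) / D / 2).
  have gap' : 0 < (phi t - eta * expR ((C + 1) * t)) / D.
    by rewrite divr_gt0// subr_gt0.
  have h0 : 0 < h by rewrite !lt_min t_gt0 (divr_gt0 d0)//= divr_gt0.
  have hd : h <= d / 2 by rewrite !ge_min lexx.
  have ht : h <= t by rewrite !ge_min lexx orbT.
  have hg : h <= (phi t - eta * expR ((C + 1) * t)) / D / 2.
    by rewrite !ge_min lexx !orbT.
  have s0 : 0 <= t - h by rewrite subr_ge0.
  have st : t - h < t by lra.
  have sS := tS _ s0 st.
  have := dH (t - h) s0.
  rewrite (_ : t - h - t = - h); last by ring.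
  rewrite normrN gtr0_norm// => /(_ ltac:(lra)).
  rewrite ler_norml => /andP[lo _].
  have e1 : expR ((C + 1) * (t - h)) <= expR ((C + 1) * t).
    by rewrite ler_expR ler_wpM2l ?addr_ge0// ltW.
  have hD : h * D <= (phi t - eta * expR ((C + 1) * t)) / 2.
    apply: le_trans (ler_wpM2r (ltW D0) hg) _.
    by rewrite mulrAC divfK ?gt_eqF.
  have e2 := ler_wpM2l (ltW eta0) e1.
  rewrite -/D in lo; lra.
(* The error e is the barrier height at t: the slope is then at most C + 1 times that height, and 1
   + x <= exp(x) keeps phi below the barrier up to t + d, against the choice of t as an infimum. *)
have [d d0 dH] := H t (eta * expR ((C + 1) * t)) t0
  (mulr_gt0 eta0 (expR_gt0 _)).
have : t + d <= t.
  apply: lb_le_inf => // s [s0 sS].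
  have ts : t <= s by apply: ge_inf.
  rewrite leNgt; apply/negP => sd.
  have := dH s s0; rewrite ger0_norm ?subr_ge0// => /(_ ltac:(lra)).
  rewrite ler_norml => /andP[_ up].
  have st0 : 0 <= s - t by lra.
  have : phi s <= eta * expR ((C + 1) * t) * (1 + (C + 1) * (s - t)).
    have := mulr_ge0 C0 st0 => ?.
    have : (s - t) * (C * phi t) <= (s - t) * (C * (eta * expR ((C + 1) * t))).
      by rewrite !ler_wpM2l.
    nra.
  have : eta * expR ((C + 1) * t) * (1 + (C + 1) * (s - t)) <=
         eta * expR ((C + 1) * s).
    rewrite -mulrA ler_wpM2l ?(ltW eta0)//.
    have -> : (C + 1) * s = (C + 1) * t + (C + 1) * (s - t) by ring.
    by rewrite expRD ler_wpM2l ?expR_ge0// expR_ge1Dx.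
  lra.
lra.
Qed.

(** The filter is abstract in order to serve both the punctured neighbourhoods of derivatives and
    the full ones of continuity. *)
Lemma cvge0_squeeze (R : realType) (G : set_system R) (FG : Filter G) (t : R)
    (f : R -> \bar R) (K d : R) : 0 < d -> G --> t ->
  (\forall s \near G, `|s - t| < d -> (0 <= f s <= (K * `|s - t|)%R%:E)%E) ->
  f s @[s --> G] --> 0%E.
Proof.
move=> d0 Gt fK.
have Kt : (K * `|s - t|)%:E @[s --> G] --> 0%E.
  apply/cvg_EFin; first by near=> s.
  rewrite -[X in _ --> X](mulr0 K); apply: cvgMr.
  rewrite -(normr0 R) -(subrr t); apply: cvg_norm; apply: cvgB => //.
  exact: cvg_cst.
apply: (@squeeze_cvge _ _ _ _ (cst 0%E) _
  (fun s => (K * `|s - t|)%:E)) => //; last first.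
  exact: cvg_cst.
have : \forall s \near G, `|s - t| < d.
  have : \forall s \near t, `|s - t| < d.
    near=> s; rewrite distrC; near: s.
    exact: nbhsx_ballx.
  exact: Gt.
by apply: filterS2 fK => s; apply.
Unshelve. all: by end_near. Qed.

(** * The essential supremum norm through almost everywhere bounds *)

Section Linfty_norm.
Context {R : realType} {n : nat}.
Implicit Types (f g : 'rV[R]_n -> R) (K : R).
Local Notation leb := (lebesgue_rV n).

Lemma Linfty_norm_leP f (y : \bar R) :
  (Linfty_norm f <= y)%E <-> {ae leb, forall x, (`|f x|%:E <= y)%E}.
Proof.
rewrite /Linfty_norm unlock /= lebesgue_rV_setT_gt0.
by split => [/ess_supP//|h]; apply/ess_supP.
Qed.

Lemma Linfty_norm_ge0 f : (0 <= Linfty_norm f)%E.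
Proof. exact: Lnorm_ge0. Qed.

Lemma Linfty_measurable f : Linfty f -> measurable_fun setT f.
Proof. by move=> /sub_Lfun_mfun; rewrite inE. Qed.

Lemma Linfty_bounded f : Linfty f ->
  {ae leb, forall x, `|f x| <= fine (Linfty_norm f)}.
Proof.
move=> /sub_Lfun_finLfun; rewrite inE /= => ffin.
have : (Linfty_norm f <= (fine (Linfty_norm f))%:E)%E.
  by rewrite fineK// ge0_fin_numE ?Linfty_norm_ge0.
by move=> /Linfty_norm_leP; apply: filterS => x; rewrite lee_fin.
Qed.

Lemma bounded_Linfty f K : measurable_fun setT f ->
  {ae leb, forall x, `|f x| <= K} -> Linfty f.
Proof.
move=> mf fK; rewrite /Linfty; apply/andP; split; rewrite inE//=.
apply: (@le_lt_trans _ _ K%:E); last exact: ltry.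
by apply/Linfty_norm_leP; apply: filterS fK => x; rewrite lee_fin.
Qed.

Lemma fine_Linfty_norm_le f K : 0 <= K ->
  {ae leb, forall x, `|f x| <= K} -> fine (Linfty_norm f) <= K.
Proof.
move=> K0 fK; have : (Linfty_norm f <= K%:E)%E.
  by apply/Linfty_norm_leP; apply: filterS fK => x; rewrite lee_fin.
have := Linfty_norm_ge0 f.
by case: (Linfty_norm f) => [r| |]//=; rewrite ?lee_fin// leNgt ltry.
Qed.

End Linfty_norm.

(** * The differential equation in L^oo for an abstract Lipschitz operator *)

Section ode.
Context {R : realType} {n : nat}.
Local Notation X := 'rV[R]_n.
Local Notation leb := (lebesgue_rV n).
Implicit Types (u v g : X -> R) (U V : R -> X -> R) (s t M K : R).

Context (A : (X -> R) -> X -> R) (C : R).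
Hypothesis C_ge0 : 0 <= C.
Hypothesis A_measurable : forall U, jointly_measurable U ->
  jointly_measurable (fun t => A (U t)).
Hypothesis A_dist : forall u v Mu Mv x y K,
  measurable_fun setT u -> measurable_fun setT v ->
  (forall z, `|u z| <= Mu) -> (forall z, `|v z| <= Mv) ->
  (forall h, `|u (x + h) - v (y + h)| <= K) -> `|A u x - A v y| <= C * K.
Hypothesis A_le : forall u M x, measurable_fun setT u ->
  (forall z, `|u z| <= M) -> `|A u x| <= C * M.
Hypothesis A_ae : forall u v, measurable_fun setT u -> measurable_fun setT v ->
  ae_equal u v -> ae_equal (A u) (A v).

(** Setting u and v to 0 on a common null set makes the three bounds hold everywhere, where [A_dist]
    applies; by [A_ae] this changes A u and A v only on a null set. *)
Lemma ae_dist u v Mu Mv K : measurable_fun setT u -> measurable_fun setT v ->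
  {ae leb, forall x, `|u x| <= Mu} -> {ae leb, forall x, `|v x| <= Mv} ->
  {ae leb, forall x, `|u x - v x| <= K} ->
  {ae leb, forall x, `|A u x - A v x| <= C * K}.
Proof.
move=> mu mv uM vM uvK.
have [N [mN N0 NP]] : {ae leb, forall x,
    [/\ `|u x| <= Mu, `|v x| <= Mv & `|u x - v x| <= K]}.
  by apply: filterS3 uM vM uvK => x.
(* A point outside N shows that the three bounds are non-negative, as needed where the cut functions
   vanish. *)
have [y yN] : exists y, ~ N y.
  apply/existsNP => NT; have := lebesgue_rV_setT_gt0 R n.
  by rewrite (_ : setT = N) ?N0 ?ltxx//; apply/seteqP; split.
have Nout x : ~ N x -> [/\ `|u x| <= Mu, `|v x| <= Mv & `|u x - v x| <= K].
  by move=> xN; apply: contrapT => h; apply/xN/NP.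
have [Mu0 Mv0 K0] : [/\ 0 <= Mu, 0 <= Mv & 0 <= K].
  by have [h1 h2 h3] := Nout y yN; split;
    [exact: le_trans h1|exact: le_trans h2|exact: le_trans h3].
pose cut f x : R := f x * \1_(~` N) x.
have mcut f : measurable_fun setT f -> measurable_fun setT (cut f).
  move=> mf; apply: measurable_funM => //; apply: measurable_indic.
  exact: measurableC.
have cutN f x : N x -> cut f x = 0.
  by move=> Nx; rewrite /cut indicE memNset ?mulr0//; exact.
have cutC f x : ~ N x -> cut f x = f x.
  by move=> Nx; rewrite /cut indicE mem_set ?mulr1.
have aecut f : ae_equal (cut f) f.
  exists N; split => // x /= h; apply: contrapT => /cutC e.
  by apply: h => _; exact: e.
have Acut f : measurable_fun setT f -> ae_equal (A (cut f)) (A f).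
  by move=> mf; apply: A_ae => //; exact: mcut.
apply: filterS2 (Acut u mu) (Acut v mv) => x /(_ I) <- /(_ I) <-.
apply: (A_dist (Mu := Mu) (Mv := Mv)) => //; try exact: mcut.
- move=> x'; have [Nx|Nx] := pselect (N x'); first by rewrite cutN// normr0.
  by rewrite cutC//; have [] := Nout _ Nx.
- move=> x'; have [Nx|Nx] := pselect (N x'); first by rewrite cutN// normr0.
  by rewrite cutC//; have [] := Nout _ Nx.
- move=> h; have [Nx|Nx] := pselect (N (x + h)).
    by rewrite !cutN// subrr normr0.
  by rewrite !cutC//; have [] := Nout _ Nx.
Qed.

Lemma Linfty_derivative_ae U V : Linfty_derivative U V ->
  forall t e, 0 <= t -> 0 < e ->
  exists2 d, 0 < d & forall s, 0 <= s -> `|s - t| < d ->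
   {ae leb, forall x, `|U s x - U t x - (s - t) * V t x| <= `|s - t| * e}.
Proof.
move=> UV t e t0 e0; have := UV t t0.
have : nbhs 0%E [set y : \bar R | (y < e%:E)%E].
  apply: open_nbhs_nbhs; split; last by rewrite /= lte_fin.
  exact: open_ereal_lt_ereal.
move=> /[swap] /[apply]; rewrite /= => /nbhs_ballP[d /= d0 dH].
exists d => // s s0 std.
have [->|st] := eqVneq s t.
  by apply: aeW => x; rewrite !subrr mul0r subr0 normr0 mul0r.
have := dH s; rewrite /ball /= distrC => /(_ std st s0)/ltW/Linfty_norm_leP.
apply: filterS => x; rewrite lee_fin /= /GRing.scale /= => h.
rewrite (_ : U s x - U t x - _ =
    (s - t) * ((s - t)^-1 * (U s x - U t x) - V t x)).
  by rewrite normrM ler_wpM2l.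
by rewrite mulrBr mulrA divff ?subr_eq0// mul1r.
Qed.

Lemma C1_solution_unique (u0 : X -> R) U V :
  C1_solution A u0 U -> C1_solution A u0 V ->
  forall t, 0 <= t -> ae_equal (V t) (U t).
Proof.
move=> [Uoo U0 [U' [_ dU _ U'E]]] [Voo V0 [V' [_ dV _ V'E]]].
pose phi t := fine (Linfty_norm (V t \- U t)).
have mU t : 0 <= t -> measurable_fun setT (U t).
  by move=> /Uoo; exact: Linfty_measurable.
have mV t : 0 <= t -> measurable_fun setT (V t).
  by move=> /Voo; exact: Linfty_measurable.
have phi_ge0 t : 0 <= phi t by rewrite fine_ge0// Linfty_norm_ge0.
have VUoo t : 0 <= t -> Linfty (V t \- U t).
  move=> t0; apply: (@bounded_Linfty _ _ _
    (fine (Linfty_norm (V t)) + fine (Linfty_norm (U t)))).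
    by apply: measurable_funB; [exact: mV|exact: mU].
  apply: filterS2 (Linfty_bounded (Voo t t0)) (Linfty_bounded (Uoo t t0)).
  by move=> x h1 h2; apply: le_trans (ler_normB _ _) _; exact: lerD.
have VU t : 0 <= t -> {ae leb, forall x, `|V t x - U t x| <= phi t}.
  by move=> /VUoo/Linfty_bounded.
suff phi_eq0 t : 0 <= t -> phi t = 0.
  move=> t t0; apply: filterS (VU t t0) => x.
  by rewrite phi_eq0// normr_le0 subr_eq0 => /eqP.
apply: dini_gronwall C_ge0 _ _ _ t => //.
  apply/eqP; rewrite eq_le phi_ge0 andbT; apply: fine_Linfty_norm_le => //.
  apply: filterS2 U0 V0 => x /(_ I) e1 /(_ I) e2.
  by rewrite /= e1 e2 subrr normr0.
move=> t e t0 e0; have e20 : 0 < e / 2 by rewrite divr_gt0.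
have [d1 d10 dU1] := Linfty_derivative_ae dU t0 e20.
have [d2 d20 dV1] := Linfty_derivative_ae dV t0 e20.
exists (Num.min d1 d2); first by rewrite lt_min d10.
move=> s s0; rewrite lt_min => /andP[sd1 sd2].
have AVU : {ae leb, forall x, `|A (V t) x - A (U t) x| <= C * phi t}.
  exact: (ae_dist (mV _ t0) (mU _ t0) (Linfty_bounded (Voo t t0))
    (Linfty_bounded (Uoo t t0)) (VU t t0)).
have inc : {ae leb, forall x, `|(V s x - U s x) - (V t x - U t x)| <=
    `|s - t| * (C * phi t + e)}.
  have hU : {ae leb, forall x,
      `|U s x - U t x - (s - t) * A (U t) x| <= `|s - t| * (e / 2)}.
    by apply: filterS2 (dU1 s s0 sd1) (U'E t t0) => x + /(_ I) <-.
  have hV : {ae leb, forall x,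
      `|V s x - V t x - (s - t) * A (V t) x| <= `|s - t| * (e / 2)}.
    by apply: filterS2 (dV1 s s0 sd2) (V'E t t0) => x + /(_ I) <-.
  apply: filterS3 hU hV AVU => x xU xV xA.
  rewrite (_ : _ - _ = (V s x - V t x - (s - t) * A (V t) x) -
    (U s x - U t x - (s - t) * A (U t) x) +
    (s - t) * (A (V t) x - A (U t) x)); last by ring.
  apply: le_trans (ler_normD _ _) _; rewrite normrM.
  have h1 := ler_wpM2l (normr_ge0 (s - t)) xA.
  apply: le_trans (lerD (le_trans (ler_normB _ _) (lerD xV xU)) h1) _.
  rewrite le_eqVlt; apply/orP; left; apply/eqP; by field.
have D0 : 0 <= `|s - t| * (C * phi t + e).
  by rewrite mulr_ge0// addr_ge0 ?(ltW e0)// mulr_ge0.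
have lo : phi t <= phi s + `|s - t| * (C * phi t + e).
  apply: fine_Linfty_norm_le; first by rewrite addr_ge0.
  apply: filterS2 inc (VU s s0) => x h1 h2 /=.
  rewrite -(subrK (V s x - U s x) (V t x - U t x)) addrC.
  by apply: le_trans (ler_normD _ _) _; apply: lerD => //; rewrite distrC.
have up : phi s <= phi t + `|s - t| * (C * phi t + e).
  apply: fine_Linfty_norm_le; first by rewrite addr_ge0.
  apply: filterS2 inc (VU t t0) => x h1 h2 /=.
  rewrite -(subrK (V t x - U t x) (V s x - U s x)) addrC.
  by apply: le_trans (ler_normD _ _) _; exact: lerD.
by rewrite ler_norml; apply/andP; split; lra.
Qed.

Lemma picard_C1_solution g M U : measurable_fun setT g ->
  (forall x, `|g x| <= M) -> jointly_measurable U ->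
  (forall t x, 0 <= t -> `|U t x| <= M * expR (C * t)) ->
  (forall t x, 0 <= t -> U t x = picard A g U t x) ->
  C1_solution A g U.
Proof.
move=> mg gM mU UM Ueq; have M0 : 0 <= M by apply: le_trans (gM 0).
have mUt t : measurable_fun setT (U t) by exact: jointly_measurable_at.
have mAUt t : measurable_fun setT (A (U t)).
  exact: (jointly_measurable_at t (A_measurable mU)).
split.
- move=> t t0; apply: bounded_Linfty (mUt t) _; apply: aeW => x.
  exact: UM.
- apply: aeW => x _; rewrite Ueq// /picard set_itv1 Rintegral_set1 addr0//.
(* The horizon t + 1 contains all times within distance 1 of t, so B does not depend on s. *)
have inc t s x : 0 <= t -> 0 <= s -> `|s - t| < 1 ->
    let B := C * (M * expR (C * (t + 1))) in
    `|U s x - U t x| <= B * `|s - t| /\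
    `|U s x - U t x - (s - t) * A (U t) x| <= C * B * `|s - t| ^+ 2.
  move=> t0 s0; rewrite ltr_norml => /andP[st1 st2] B.
  by apply: (picard_increment C_ge0 A_measurable A_dist A_le gM x mU UM Ueq);
    apply/andP; split; lra.
exists (fun t => A (U t)); split.
- move=> t t0; apply: bounded_Linfty (mAUt t) _; apply: aeW => x.
  by apply: A_le => // z; exact: UM.
- move=> t t0; pose B := C * (M * expR (C * (t + 1))).
  apply: (@cvge0_squeeze _ _ _ t _ (C * B) 1) => //.
    by apply: cvg_trans (@cvg_within _ (nbhs t) _ _); exact: cvg_within.
  rewrite near_withinE; near=> s => s0 st; rewrite Linfty_norm_ge0 /=.
  have sneq : s != t by near: s; exact: nbhs_dnbhs_neq.
  apply/Linfty_norm_leP; apply: aeW => x; rewrite lee_fin /= /GRing.scale /=.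
  have [_ h] := inc t s x t0 s0 st.
  have st0 : 0 < `|s - t| by rewrite normr_gt0 subr_eq0.
  rewrite -(ler_pM2l st0) -normrM mulrBr mulrA divff ?subr_eq0// mul1r.
  apply: le_trans h _; rewrite -/B le_eqVlt; apply/orP; left; apply/eqP.
  by ring.
- move=> t t0; pose B := C * (M * expR (C * (t + 1))).
  apply: (@cvge0_squeeze _ _ _ t _ (C * B) 1) => //.
    exact: cvg_within.
  rewrite near_withinE; near=> s => s0 st; rewrite Linfty_norm_ge0 /=.
  apply/Linfty_norm_leP; apply: aeW => x; rewrite lee_fin /= -mulrA.
  apply: A_dist (mUt s) (mUt t) (UM s ^~ s0) (UM t ^~ t0) _ => h.
  by have [] := inc t s (x + h) t0 s0 st.
- by move=> t t0; exact: aeW.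
Unshelve. all: by end_near. Qed.

End ode.

(** * Well-posedness *)

Section clamp.
Context {R : realType} (M : R).
Hypothesis M_ge0 : 0 <= M.
Implicit Types a b : R.

(** Truncation at the L^oo norm makes a representative bounded everywhere, changes it only on a null
    set and, being 1-Lipschitz, preserves Lipschitz bounds. *)
Definition clamp a : R := Num.max (- M) (Num.min M a).

Lemma clamp_le a : `|clamp a| <= M.
Proof.
by rewrite ler_norml /clamp le_max lexx ge_max ge_min lexx orTb andbT ge0_cp.
Qed.

Lemma clamp_id a : `|a| <= M -> clamp a = a.
Proof.
rewrite ler_norml /clamp => /andP[aM Ma].
by rewrite (min_idPr Ma) (max_idPr aM).
Qed.

Lemma clamp_lipschitz a b : `|clamp a - clamp b| <= `|a - b|.
Proof.
wlog ab : a b / a <= b.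
  move=> H; have [|/ltW] := leP a b; first exact: H.
  by rewrite distrC (distrC a); exact: H.
rewrite distrC (distrC a) (ger0_norm (_ : 0 <= b - a)) ?subr_ge0// ler_norml.
rewrite /clamp /Num.max /Num.min; do ! case: ifPn; rewrite -?leNgt => *;
  apply/andP; split; lra.
Qed.

End clamp.

(** The squared coordinates of a unit normal add up to 1, so the mass is the sum of the diagonal
    conditions, the trace of the identity. *)
Lemma isotropic_mass (R : realType) d
    (w : {measure set (sphere R d) -> \bar R}) :
  (forall i : 'I_d.+1,
    (\int[w]_n (normal n 0 i * normal n 0 i)%:E)%E = 1%:E) ->
  w setT = (d.+1%:R)%:E.
Proof.
move=> iso.
have mn i : measurable_fun setT (fun n : sphere R d => normal n 0 i).
  exact: (measurableT_comp (measurable_coord i) (@measurable_normal R d)).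
transitivity (\int[w]_n (\sum_(i < d.+1) (normal n 0 i * normal n 0 i)%:E))%E.
  rewrite -[LHS]mul1e -integral_cst//; apply: eq_integral => n _.
  rewrite sumEFin; congr (_%:E); have := Defs.normalP n.
  rewrite /enorm => /eqP n1; rewrite -[RHS](sqr_sqrtr (edot_ge0 _)).
  by rewrite -/(enorm _) /enorm n1 expr1n.
rewrite ge0_integral_sum//.
- by under eq_bigr do rewrite iso; rewrite sumEFin sumr_const card_ord.
- by move=> i; apply/measurable_EFinP; exact: measurable_funM.
- by move=> i n _; rewrite lee_fin -expr2 sqr_ge0.
Qed.

(** Positive dimension provides two distinct points; over an empty set of pairs the supremum would
    be -oo. *)
Lemma lip_seminorm_ge0 (R : realType) n (v : 'rV[R]_n.+1 -> R) :
  (0 <= lip_seminorm v)%E.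
Proof.
have d0 : delta_mx 0 0 != 0 :> 'rV[R]_n.+1.
  by apply/eqP => /rowP/(_ 0); rewrite !mxE !eqxx /= => /eqP; rewrite oner_eq0.
apply: (@le_trans _ _
  (`|v (delta_mx 0 0) - v 0| / enorm (delta_mx 0 0 - 0))%:E).
  by rewrite lee_fin divr_ge0// enorm_ge0.
by apply: ereal_sup_ubound; exists (delta_mx 0 0, 0).
Qed.

Lemma lip_seminorm_leP (R : realType) n (v : 'rV[R]_n -> R) (K : R) :
  (lip_seminorm v <= K%:E)%E <->
  (forall x y, `|v x - v y| <= K * enorm (x - y)).
Proof.
have e0 (x y : 'rV[R]_n) : x != y -> 0 < enorm (x - y).
  move=> xy; rewrite lt_def enorm_ge0 andbT; apply: contra_neq xy => /enorm_eq0.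
  by move=> /eqP; rewrite subr_eq0 => /eqP.
split => [vK x y|vK].
  have [->|xy] := eqVneq x y.
    by rewrite !subrr normr0 enorm0 mulr0.
  rewrite -ler_pdivrMr ?e0// -lee_fin; apply: le_trans vK.
  by apply: ereal_sup_ubound; exists (x, y).
apply: ge_ereal_sup => _ [[x y] /= xy <-].
by rewrite lee_fin ler_pdivrMr ?e0.
Qed.

Theorem proposition3p1 (R : realType) (d : nat)
    (w : {measure set (sphere R d) -> \bar R})
    (w_radon : radon w)
    (w_isotropic : forall i j : 'I_d.+1,
       (\int[w]_n (normal n 0 i * normal n 0 j)%:E)%E = ((i == j)%:R)%:E)
    (Phi : averaging_filter R)
    (F : R -> 'rV[R]_d.+1) (F0 : F 0 = 0)
    (L : R) (F_lipschitz : forall a b : R, enorm (F a - F b) <= L * `|a - b|)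
    (u0 : 'rV[R]_d.+1 -> R) (u0_Linfty : Linfty u0) :
  (exists u : R -> 'rV[R]_d.+1 -> R,
     C1_solution (upwind_div Phi w F) u0 u /\
     forall v : R -> 'rV[R]_d.+1 -> R,
       C1_solution (upwind_div Phi w F) u0 v ->
       forall t : R, 0 <= t -> ae_equal (v t) (u t)) /\
  (forall u : R -> 'rV[R]_d.+1 -> R,
     C1_solution (upwind_div Phi w F) u0 u ->
     forall g0 : 'rV[R]_d.+1 -> R,
       ae_equal g0 u0 -> (lip_seminorm g0 < +oo)%E ->
       forall t : R, 0 <= t ->
       exists g : 'rV[R]_d.+1 -> R,
         ae_equal g (u t) /\
         (lip_seminorm g <= lip_seminorm g0 *
            (expR (4 * L * fine (w setT) * filter_at0 Phi * t))%:E)%E).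
Proof.
have w_fin : (w setT < +oo)%E.
  by rewrite isotropic_mass ?ltry// => i; rewrite w_isotropic eqxx.
pose A := upwind_div Phi w F; pose C := upwind_rate w Phi L.
have C0 : 0 <= C by exact: upwind_rate_ge0 F_lipschitz.
have A_measurable U :
    jointly_measurable U -> jointly_measurable (fun t => A (U t)).
  exact: (@measurable_upwind_div _ _ w Phi F L w_fin F_lipschitz _ _
    (fun p => U p.1 p.2)).
have A_dist := @upwind_div_dist _ _ w Phi F L w_fin F_lipschitz.
have A_le := @upwind_div_le _ _ w Phi F L w_fin F_lipschitz.
have A_ae := @ae_equal_upwind_div _ _ w Phi F L w_fin F_lipschitz.
pose M := fine (Linfty_norm u0).
have M0 : 0 <= M by rewrite fine_ge0// Linfty_norm_ge0.
(* The representative g is left free: existence starts from the truncation of [u0], the Lipschitz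
   bound from that of [g0]. *)
have wellposed (g : 'rV[R]_d.+1 -> R) :
    measurable_fun setT g -> (forall x, `|g x| <= M) -> ae_equal g u0 ->
    exists U, C1_solution A u0 U /\
      forall x y K t, 0 <= t -> (forall h, `|g (x + h) - g (y + h)| <= K) ->
        `|U t x - U t y| <= K * expR (C * t).
  move=> mg gM gu0.
  have [U [mU UM Ueq Ulip]] := picard_solution C0 A_measurable
    A_dist A_le mg gM.
  have [h1 h2 h3] := picard_C1_solution C0 A_measurable A_dist A_le
    mg gM mU UM Ueq.
  exists U; split => //; split => //.
  by apply: filterS2 h2 gu0 => x /(_ I) -> /(_ I) ->.
have unique U V := @C1_solution_unique _ _ A C C0 A_dist A_ae u0 U V.
have clamp_u0 (f : 'rV[R]_d.+1 -> R) :
    ae_equal f u0 -> ae_equal (clamp M \o f) u0.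
  move=> fu0; apply: filterS2 fu0 (Linfty_bounded u0_Linfty).
  by move=> x /(_ I) /= -> h _; exact: clamp_id.
split.
  have [|||u [solu _]] := @wellposed (clamp M \o u0).
  - rewrite /clamp; apply: measurable_maxr => //; apply: measurable_minr => //.
    exact: Linfty_measurable.
  - by move=> x; exact: clamp_le.
  - by apply: clamp_u0; exact: aeW.
  by exists u; split => // v solv t t0; exact: unique solu solv t t0.
(* The given u carries no pointwise information, so a second solution is built from the truncated
   [g0]; its value at t is the Lipschitz representative, equal to u t almost everywhere by
   uniqueness. *)
move=> u solu g0 g0u0 lipg0 t t0.
pose K := fine (lip_seminorm g0).
have KE : lip_seminorm g0 = K%:E.
  by rewrite /K fineK// ge0_fin_numE// lip_seminorm_ge0.
have g0K : forall x y, `|g0 x - g0 y| <= K * enorm (x - y).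
  by apply/lip_seminorm_leP; rewrite KE.
have gK x y : `|(clamp M \o g0) x - (clamp M \o g0) y| <= K * enorm (x - y).
  by apply: le_trans (g0K x y); exact: clamp_lipschitz.
have [|||U [solU Ulip]] := @wellposed (clamp M \o g0).
- exact: lipschitz_measurable_rV gK.
- by move=> x; exact: clamp_le.
- exact: clamp_u0.
exists (U t); split; first exact: unique solu solU t t0.
rewrite KE -EFinM; apply/lip_seminorm_leP => x y.
rewrite mulrAC; apply: Ulip => // h.
apply: le_trans (gK _ _) _.
by rewrite opprD addrACA subrr addr0.
Qed.
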